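(* On finite graphs, the spin-spin two-point function $\langle\sigma_x\cdot\sigma_y\rangle$ of the Villain model with couplings $\beta J_{u,v}>0$ and free boundary conditions is, for every pair of vertices $x,y$, monotone non-decreasing in the coupling constant of each edge, and hence monotone non-decreasing in the volume of the system (i.e. under passing from a finite graph to a larger finite graph containing it as a subgraph, with the same couplings on the common edges). Consequently, on infinite locally finite graphs, the infinite-volume limit of the two-point function, along increasing finite subgraphs exhausting the graph, exists.
   Context: Villain model on a finite graph $(V,E)$ with couplings $J_{u,v}>0$ at inverse temperature $\beta>0$, free boundary conditions: spins $\sigma_x=e^{i\theta_x}\in\mathbb S^1$, $\theta\in[-\pi,\pi)^V$, with probability density proportional to $\prod_{\{u,v\}\in E}\sum_{m\in\mathbb Z}\exp\big(-\frac{\beta J_{u,v}}2(\theta_u-\theta_v+2\pi m)^2\big)$, and $\langle\sigma_x\cdot\sigma_y\rangle$ is the expectation of $\cos(\theta_x-\theta_y)$. *)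

(* Defs.v *)
From HB Require Import structures.
From mathcomp Require Import all_boot all_order all_algebra finmap.
From mathcomp Require Import all_classical all_reals all_analysis.

Set Implicit Arguments.
Unset Strict Implicit.
Unset Printing Implicit Defensive.

Import Order.TTheory GRing.Theory Num.Theory numFieldNormedType.Exports.

Local Open Scope classical_set_scope.
Local Open Scope fset_scope.
Local Open Scope ring_scope.

(* The edge {u, v} is the two-element set [fset u; v], so that couplings are
   functions on unordered pairs. *)
Record finite_graph (V : choiceType) := FiniteGraph {
  verts : {fset V};
  edges : {fset {fset V}};
  edges_card2 : forall e, e \in edges -> #|` e| = 2%N;
  edges_verts : forall e, e \in edges -> e `<=` verts
}.

Definition subgraph (V : choiceType) (G H : finite_graph V) : Prop :=
  verts G `<=` verts H /\ edges G `<=` edges H.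

(* A possibly infinite graph, whose vertex set is the whole type V. *)
Record graph (V : choiceType) := Graph {
  gedges : set {fset V};
  gedges_card2 : forall e, gedges e -> #|` e| = 2%N
}.

Definition locally_finite (V : choiceType) (g : graph V) : Prop :=
  forall x : V, finite_set [set e : {fset V} | gedges g e /\ x \in e].

Definition exhaustion (V : choiceType) (g : graph V) (G : nat -> finite_graph V) :
  Prop :=
  [/\ forall n e, e \in edges (G n) -> gedges g e,
      forall n, subgraph (G n) (G n.+1),
      forall x : V, exists n, x \in verts (G n)
    & forall e, gedges g e -> exists n, e \in edges (G n)].

Section Villain.
Variable R : realType.

Definition villain_weight (K phi : R) : R :=
  fine (\esum_(m in [set: int])
    (expR (- (K / 2) * (phi + 2 * pi * m%:~R) ^+ 2))%:E).

Variable V : choiceType.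
Implicit Types (theta : V -> R) (e : {fset V}) (G : finite_graph V).

(* theta_u - theta_v for e = {u, v}; the sign depends on the enumeration of e,
   which is harmless because villain_weight K is even. *)
Definition edge_diff theta e : R :=
  if enum_fset e is [:: u; v] then theta u - theta v else 0.

Definition gibbs_weight (beta : R) (J : {fset V} -> R) G theta : R :=
  \prod_(e <- edges G) villain_weight (beta * J e) (edge_diff theta e).

(* Lebesgue integral over the angles indexed by s (assumed duplicate-free),
   each in [-pi, pi[, the other angles being frozen to their value in theta.
   It is an iterated integral; for the bounded continuous integrands used here
   Fubini's theorem makes it the integral against the product measure. *)
Fixpoint angle_integral (s : seq V) (F : (V -> R) -> R) theta : R :=
  if s is x :: s' then
    \int[@lebesgue_measure R]_(t in `[- pi, pi[)
      angle_integral s' F [eta theta with x |-> t]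
  else F theta.

(* Every angle of G is integrated, so when F only depends on those angles the
   initial configuration 0 plays no role. *)
Definition config_integral G (F : (V -> R) -> R) : R :=
  angle_integral (enum_fset (verts G)) F (fun=> 0).

Definition partition_function (beta : R) (J : {fset V} -> R) G : R :=
  config_integral G (gibbs_weight beta J G).

Definition expectation_villain (beta : R) (J : {fset V} -> R) G
    (F : (V -> R) -> R) : R :=
  config_integral G (fun theta => F theta * gibbs_weight beta J G theta) /
  partition_function beta J G.

(* Meaningful only for x and y in verts G. *)
Definition two_point (beta : R) (J : {fset V} -> R) G (x y : V) : R :=
  expectation_villain beta J G (fun theta => cos (theta x - theta y)).

End Villain.

(* Main.v *)
Require Import Defs.
From HB Require Import structures.
From mathcomp Require Import all_boot all_order all_algebra finmap.
From mathcomp Require Import all_classical all_reals all_analysis.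
From mathcomp Require Import measurable_realfun ring lra zify.

Set Implicit Arguments.
Unset Strict Implicit.
Unset Printing Implicit Defensive.

Import Order.TTheory GRing.Theory Num.Theory numFieldNormedType.Exports.

Local Open Scope classical_set_scope.
Local Open Scope ring_scope.

(** Ginibre's duplication argument. Write [V K] for [villain_weight K]. Summing
    over the parity of [m - m'] in the product of two Villain sums gives
      [V K (p + q) * V K (p - q)
         = V (2 K) p * V (2 K) q + V (2 K) (p + pi) * V (2 K) (q + pi)],
    so in the rotated variables [(theta, theta') = (s + d, s - d)] a product of
    two Villain weights is a sum of terms [F s * F d]. If [W] is a positive
    combination of the symmetrised translates of [V], the same identity turns
    [V theta * W theta' - W theta * V theta'] into minus such a sum, while
    [cos (s + d) - cos (s - d) = - 2 sin s sin d]; the difference of the two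
    correlations, cleared of denominators, is then an integral of squares.
    Increasing a coupling is the case where [W] is the convolution of [V] with a
    Gaussian; adding an edge is the case where [W = 1] is the average of all the
    translates of [V]. Torus integrals are limits of sums over the grid of odd
    order [2 n + 1], where halving is possible, so that the rotation is a
    bijection of finite sets and no Fubini theorem is needed. *)

(** * The Villain weight *)

Section VillainWeight.
Variable R : realType.
Implicit Types (K phi : R) (m : int).

(** Pairing [Posz k] with [Negz k] turns the unordered sum into a nonnegative series over [nat], to
    which monotone convergence and comparison of partial sums apply. *)
Lemma esum_int (a : int -> \bar R) : (forall m, 0 <= a m)%E ->
  (\esum_(m in [set: int]) a m =
   \sum_(0 <= k <oo) (a (Posz k) + a (Negz k)))%E.
Proof.
move=> a0; rewrite (esumID (range Posz))//= !setTI.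
have -> : ~` range Posz = range Negz.
  apply/seteqP; split => [[k|k]|[k|k]] //=; first by case; exists k.
  - by move=> _; exists k.
  - by case.
  - by move=> _ [].
rewrite !esum_image//; last 2 first.
- by move=> i j _ _ [].
- by move=> i j _ _ [].
by rewrite -esumD// nneseries_esumT// => n; exact: adde_ge0.
Qed.

Definition villain_term K phi m : R :=
  expR (- (K / 2) * (phi + 2 * pi * m%:~R) ^+ 2).

Lemma villain_term_ge0 K phi m : 0 <= villain_term K phi m.
Proof. exact: expR_ge0. Qed.

Definition villain_esum K phi : \bar R :=
  (\esum_(m in [set: int]) (villain_term K phi m)%:E)%E.

Lemma villain_esum_ge0 K phi : (0 <= villain_esum K phi)%E.
Proof. by apply: esum_ge0 => m _; rewrite lee_fin villain_term_ge0. Qed.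

Lemma int_shift_bij (k : int) : set_bij [set: int] [set: int] (fun m => m + k).
Proof.
split => //= [i j _ _ /addIr //|m _]; exists (m - k) => //.
by rewrite subrK.
Qed.

Lemma villain_esum_periodic K phi (k : int) :
  villain_esum K (phi + 2 * pi * k%:~R) = villain_esum K phi.
Proof.
rewrite /villain_esum [RHS](reindex_esum _ _ _ _ (int_shift_bij k)).
apply: eq_esum => m _; congr (expR _)%:E; congr (_ * _ ^+ 2).
by rewrite rmorphD/=; ring.
Qed.

Lemma esum_geo (c q : R) : 0 <= c -> 0 <= q < 1 ->
  (\esum_(m in [set: int]) (c * q ^+ `|m|%N)%:E <= (c * (2 * (1 - q)^-1))%:E)%E.
Proof.
move=> c0 /andP[q0 q1].
have cq n : 0 <= c * q ^+ n by rewrite mulr_ge0// exprn_ge0.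
rewrite esum_int; last by move=> m; rewrite lee_fin cq.
apply: lime_le.
  by apply: is_cvg_nneseries => n _ _; rewrite adde_ge0// lee_fin cq.
apply: nearW => n; under eq_bigr do rewrite -EFinD.
rewrite sumEFin lee_fin.
apply: (@le_trans _ _ (\sum_(0 <= i < n) c * (2 * q ^+ i))).
  apply: ler_sum => i _ /=; rewrite -mulrDr ler_wpM2l//.
  by rewrite exprS mulr_natl mulr2n lerD2l ler_piMl ?exprn_ge0// ltW.
rewrite -mulr_sumr ler_wpM2l// -mulr_sumr ler_pM2l//.
rewrite -[leRHS]mul1r ler_pdivlMr ?subr_gt0//.
rewrite mulrC -opprB mulNr big_mkord -subrX1 opprB lerBlDl lerDr exprn_ge0//.
Qed.

(** For [m != 0] this is [2 * pi * |m| - (pi + 1) >= |m|], which follows from [pi >= 2]. The margin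
    1 beyond [pi] leaves room for two angles at distance at most 1, only one of which is reduced. *)
Lemma norm_pi_shift phi m : `|phi| <= pi + 1 ->
  (`|m|%N)%:R <= `|phi + 2 * pi * m%:~R|.
Proof.
move=> hphi.
have pi2 := pi_ge2 R.
have [->|m0] := eqVneq m 0; first by rewrite absz0.
have m1 : 1 <= (`|m|%N)%:R :> R by rewrite ler1n absz_gt0.
have hm : `|2 * pi * m%:~R| = 2 * pi * (`|m|%N)%:R :> R.
  rewrite normrM ger0_norm ?mulr_ge0 ?pi_ge0//; congr (_ * _).
  by rewrite -intr_norm natr_absz.
have := lerB_dist (2 * pi * m%:~R) (- phi); rewrite opprK normrN hm addrC.
rewrite (addrC (_ * _)) => h.
set a := (`|m|%N)%:R in m1 h *.
nra.
Qed.

Lemma expR_gap (a b : R) : `|expR (- a) - expR (- b)| <=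
  expR (- Num.min a b) * `|a - b|.
Proof.
wlog ab : a b / a <= b.
  move=> H; have /orP[/H//|/H h] := le_total a b.
  by rewrite distrC (distrC a) minC.
rewrite min_l// ger0_norm ?subr_ge0 ?ler_expR ?lerN2//.
rewrite distrC ger0_norm ?subr_ge0//.
have -> : expR (- b) = expR (- a) * expR (- (b - a)) by rewrite -expRD; congr expR; ring.
rewrite -{1}[expR (- a)]mulr1 -mulrBr ler_wpM2l ?expR_ge0//.
by have := expR_ge1Dx (- (b - a)); lra.
Qed.

(** Since [k <= k ^ 2], Gaussian decay in [u] is at least geometric decay in [k]; with [k = |m|]
    this compares the Villain series with a geometric one. *)
Lemma gauss_tail K (u : R) (k : nat) : 0 < K -> k%:R <= `|u| ->
  expR (- (K * u ^+ 2)) <= expR (- K) ^+ k.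
Proof.
move=> K0 ku; rewrite -expRM_natl ler_expR mulrN lerN2 mulrC ler_pM2l//.
rewrite -real_normK ?num_real//; apply: (le_trans _ (_ : k%:R ^+ 2 <= _)).
  rewrite -natrX ler_nat; case: k {ku} => // k; exact: leq_pmulr.
by rewrite ler_pXn2r// nnegrE.
Qed.

Lemma villain_term_le K phi m : 0 < K -> `|phi| <= pi + 1 ->
  villain_term K phi m <= expR (- (K / 4)) ^+ `|m|%N.
Proof.
move=> K0 hphi; have c0 : 0 < K / 4 by lra.
apply: le_trans (gauss_tail c0 (norm_pi_shift m hphi)).
rewrite /villain_term ler_expR mulNr lerN2 ler_wpM2r ?sqr_ge0//; lra.
Qed.

Lemma reduce_angle phi : exists k : int, `|phi + 2 * pi * k%:~R| <= pi.
Proof.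
have pi0 := pi_gt0 R.
pose x := (phi + pi) / (2 * pi); exists (- Num.floor x).
have /andP[h1 h2] := floor_itv x.
have e : phi + pi = x * (2 * pi) by rewrite /x divfK// mulf_neq0// gt_eqF.
rewrite rmorphN/= ler_norml; rewrite rmorphD/= in h2.
set f := (Num.floor x)%:~R in h1 h2 *.
nra.
Qed.

Lemma geo_ratio K : 0 < K -> 0 <= expR (- (K / 4)) < 1.
Proof. by move=> K0; rewrite expR_ge0 expR_lt1 oppr_lt0 divr_gt0. Qed.

Definition villain_bound K : R := 2 * (1 - expR (- (K / 4)))^-1.

Lemma villain_esum_le K phi : 0 < K ->
  (villain_esum K phi <= (villain_bound K)%:E)%E.
Proof.
move=> K0; have [k hk] := reduce_angle phi.
rewrite -(villain_esum_periodic _ _ k).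
apply: (@le_trans _ _ (1 * villain_bound K)%:E); last by rewrite mul1r.
apply: le_trans (esum_geo ler01 (geo_ratio K0)).
apply: le_esum => m _; rewrite lee_fin mul1r villain_term_le//.
by rewrite (le_trans hk)// lerDl.
Qed.

Lemma villain_weightE K phi : 0 < K ->
  (villain_weight K phi)%:E = villain_esum K phi.
Proof.
move=> K0; rewrite fineK//.
rewrite ge0_fin_numE ?(le_lt_trans (villain_esum_le phi K0)) ?ltry//.
exact: villain_esum_ge0.
Qed.

Lemma villain_weight_ge0 K phi : 0 <= villain_weight K phi.
Proof. by apply: fine_ge0; exact: villain_esum_ge0. Qed.

Lemma villain_weight_le K phi : 0 < K -> villain_weight K phi <= villain_bound K.
Proof. by move=> K0; rewrite -lee_fin villain_weightE// villain_esum_le. Qed.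

Lemma villain_weight_periodic K phi (k : int) :
  villain_weight K (phi + 2 * pi * k%:~R) = villain_weight K phi.
Proof. by have /(congr1 fine) := villain_esum_periodic K phi k. Qed.

(** One term of the series suffices: the one whose shifted angle lies in [[- pi, pi]]. This bound,
    uniform in [phi], later keeps the partition functions positive. *)
Lemma villain_weight_lb K phi : 0 < K ->
  expR (- (K / 2) * pi ^+ 2) <= villain_weight K phi.
Proof.
move=> K0; have [k hk] := reduce_angle phi.
rewrite -lee_fin villain_weightE//.
apply: esum_ge; exists [set k]; first by split.
rewrite fsbig_set1 lee_fin ler_expR !mulNr lerN2 ler_wpM2l//; first by lra.
by rewrite -(real_normK (num_real (phi + _))) ler_pXn2r ?nnegrE ?pi_ge0.
Qed.

Definition villain_lip_const K : R :=
  K / 2 * ((2 + 2 * (pi + 1)) * (1 + 4 / K)).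

(** The difference of the two squared angles costs a factor affine in the smaller shifted angle. The
    exponential is split into two equal halves: one absorbs this factor, the other gives the
    geometric decay in [m] that makes the bound summable. *)
Lemma villain_term_lip K phi psi m : 0 < K ->
  `|phi| <= pi + 1 -> `|psi| <= pi + 1 ->
  `|villain_term K phi m - villain_term K psi m| <=
  villain_lip_const K * `|phi - psi| * expR (- (K / 4)) ^+ `|m|%N.
Proof.
move=> K0 hphi hpsi; have pi0 := pi_gt0 R.
have hu := norm_pi_shift m hphi; have hv := norm_pi_shift m hpsi.
rewrite /villain_term !mulNr.
have -> : `|phi - psi| = `|(phi + 2 * pi * m%:~R) - (psi + 2 * pi * m%:~R)|.
  by congr `|_|; ring.
have : `|(phi + 2 * pi * m%:~R) - (psi + 2 * pi * m%:~R)| <= 2 * (pi + 1).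
  rewrite (_ : _ - _ = phi - psi); last by ring.
  by rewrite (le_trans (ler_normB _ _))//; lra.
move: (phi + _) (psi + _) hu hv => u v hu hv D; clear phi psi hphi hpsi.
wlog uv : u v hu hv D / `|u| <= `|v|.
  move=> H; have /orP[uv|vu] := le_total `|u| `|v|; first exact: H.
  by rewrite distrC (distrC u); apply: H => //; rewrite distrC.
apply: (le_trans (expR_gap _ _)).
have c0 : 0 < K / 4 by lra.
have uv2 : u ^+ 2 <= v ^+ 2.
  by rewrite -(real_normK (num_real u)) -(real_normK (num_real v)) ler_pXn2r ?nnegrE.
rewrite min_l; last by rewrite ler_wpM2l//; lra.
have := gauss_tail c0 hu.
set g := _ ^+ `|m|%N => hg.
have e1 : `|K / 2 * u ^+ 2 - K / 2 * v ^+ 2| <=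
    K / 2 * `|u - v| * (2 * `|u| + 2 * (pi + 1)).
  rewrite -mulrBr normrM (@ger0_norm _ (K / 2)); last by lra.
  rewrite -mulrA ler_wpM2l//; first by lra.
  rewrite subr_sqr normrM ler_wpM2l//.
  rewrite (le_trans (ler_normD _ _))//.
  by have := lerB_dist v u; rewrite (distrC v u); lra.
apply: (le_trans (ler_wpM2l (expR_ge0 _) e1)).
have -> : expR (- (K / 2 * u ^+ 2)) =
    expR (- (K / 4 * u ^+ 2)) * expR (- (K / 4 * u ^+ 2)).
  by rewrite -expRD; congr expR; field.
(* The exponential beats the affine factor through [1 + t <= expR t]; the constants of
   [villain_lip_const] come from here. *)
have e2 : expR (- (K / 4 * u ^+ 2)) * (2 * `|u| + 2 * (pi + 1)) <=
    (2 + 2 * (pi + 1)) * (1 + 4 / K).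
  rewrite expRN ler_pdivrMl ?expR_gt0//.
  have h1 : 1 + K / 4 * u ^+ 2 <= expR (K / 4 * u ^+ 2) by exact: expR_ge1Dx.
  have h2 : 2 * `|u| + 2 * (pi + 1) <= (2 + 2 * (pi + 1)) * (1 + u ^+ 2).
    rewrite -(real_normK (num_real u)).
    by have := sqr_ge0 (`|u| - 1); have := sqr_ge0 `|u|; nra.
  have h3 : 1 + u ^+ 2 <= (1 + 4 / K) * (1 + K / 4 * u ^+ 2).
    rewrite (_ : (1 + 4 / K) * _ = 1 + u ^+ 2 + (4 / K + K / 4 * u ^+ 2)).
      rewrite lerDl; apply: addr_ge0; first exact: ltW (divr_gt0 _ _).
      by apply: mulr_ge0 (ltW _) (sqr_ge0 _).
    by field; rewrite gt_eqF//.
  apply: (le_trans h2).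
  rewrite [leRHS]mulrCA ler_wpM2l//; first by lra.
  apply: (le_trans h3); rewrite [leRHS]mulrC; rewrite ler_wpM2l// addr_ge0// divr_ge0//; lra.
rewrite /villain_lip_const.
move: e2 hg; set E := expR _ ; set T := 2 * `|u| + _; set M := _ * (1 + _) => e2 hg.
rewrite [leLHS](_ : _ = (K / 2 * `|u - v|) * (E * T) * E); last by ring.
rewrite [leRHS](_ : _ = (K / 2 * `|u - v|) * M * g); last by ring.
apply: ler_pM => //.
- apply: mulr_ge0; first by apply: mulr_ge0 => //; lra.
  by apply: mulr_ge0; rewrite ?expR_ge0// /T addr_ge0 ?mulr_ge0//; lra.
- exact: expR_ge0.
- by rewrite ler_wpM2l// mulr_ge0//; lra.
Qed.

Lemma villain_weight_lip_near K phi psi : 0 < K ->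
  `|phi| <= pi + 1 -> `|psi| <= pi + 1 ->
  villain_weight K phi <= villain_weight K psi +
    villain_lip_const K * `|phi - psi| * villain_bound K.
Proof.
move=> K0 hphi hpsi.
rewrite -lee_fin EFinD !villain_weightE//.
have C0 : 0 <= villain_lip_const K * `|phi - psi|.
  have pi0 := pi_gt0 R.
  have k4 : 0 <= 1 + 4 / K by rewrite addr_ge0// divr_ge0// ltW.
  have k2 : 0 <= K / 2 by lra.
  rewrite /villain_lip_const; apply: mulr_ge0 => //; apply: mulr_ge0 => //.
  by apply: mulr_ge0 => //; lra.
apply: le_trans (leeD2l _ (esum_geo C0 (geo_ratio K0))).
rewrite /villain_esum -esumD; last 2 first.
- by move=> m _; rewrite lee_fin villain_term_ge0.
- move=> m _; rewrite lee_fin mulr_ge0 ?exprn_ge0 ?expR_ge0//.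
apply: le_esum => m _; rewrite -EFinD lee_fin -lerBlDl.
by apply: le_trans (ler_norm _) (villain_term_lip _ _ _ _).
Qed.

(** For angles at distance at least 1 boundedness is enough. For closer ones, a single translation
    by a multiple of [2 * pi] brings both into [[- (pi + 1), pi + 1]], where the termwise bound has
    been summed. *)
Lemma villain_weight_lipschitz K : 0 < K ->
  exists2 L, 0 <= L & forall phi psi,
    `|villain_weight K phi - villain_weight K psi| <= L * `|phi - psi|.
Proof.
move=> K0; have B0 : 0 <= villain_bound K.
  exact: le_trans (villain_weight_ge0 K 0) (villain_weight_le _ K0).
set C := villain_lip_const K * villain_bound K.
exists (Num.max C (2 * villain_bound K)); first by rewrite le_max orbC mulr_ge0.
move=> phi psi; have [far|near] := leP 1 `|phi - psi|.
  apply: (@le_trans _ _ (2 * villain_bound K * `|phi - psi|)); last first.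
    by rewrite ler_wpM2r// le_max lexx orbT.
  apply: (@le_trans _ _ (2 * villain_bound K)); last first.
    by rewrite ler_peMr// mulr_ge0.
  rewrite (le_trans (ler_normB _ _))// !ger0_norm ?villain_weight_ge0//.
  by rewrite mulr_natl mulr2n lerD// villain_weight_le.
have [k hk] := reduce_angle phi.
rewrite -(villain_weight_periodic _ phi k) -(villain_weight_periodic _ psi k).
have -> : `|phi - psi| = `|(phi + 2 * pi * k%:~R) - (psi + 2 * pi * k%:~R)|.
  by congr `|_|; ring.
have : `|psi + 2 * pi * k%:~R| <= pi + 1.
  rewrite (_ : _ + _ = (phi + 2 * pi * k%:~R) - (phi - psi)); last by ring.
  by rewrite (le_trans (ler_normB _ _))// lerD// ltW.
have : `|phi + 2 * pi * k%:~R| <= pi + 1 by rewrite (le_trans hk)// lerDl.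
move: (phi + _) (psi + _) => u v hu hv {hk near}.
apply: (@le_trans _ _ (C * `|u - v|)); last first.
  by rewrite ler_wpM2r// le_max lexx.
have h1 := villain_weight_lip_near K0 hu hv.
have h2 := villain_weight_lip_near K0 hv hu.
rewrite [X in _ * X * _]distrC in h2.
rewrite ler_norml /C mulrAC; apply/andP; split; lra.
Qed.

Lemma esum_intZl (c : R) (a : int -> \bar R) : 0 <= c ->
  (forall m, 0 <= a m)%E ->
  (\esum_(m in [set: int]) (c%:E * a m) = c%:E * \esum_(m in [set: int]) a m)%E.
Proof.
move=> c0 a0; have ca0 m : (0 <= c%:E * a m)%E by rewrite mule_ge0.
rewrite !esum_int// -nneseriesZl => [|k _]; last exact: adde_ge0.
by apply: eq_eseriesr => k _; rewrite ge0_muleDr.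
Qed.

Lemma esum_int_prod (a b : int -> R) (A B : R) :
  (forall m, 0 <= a m) -> (forall m, 0 <= b m) ->
  (A%:E = \esum_(m in [set: int]) (a m)%:E)%E ->
  (B%:E = \esum_(m in [set: int]) (b m)%:E)%E ->
  ((A * B)%:E = \esum_(k in [set: int * int]) (a k.1 * b k.2)%:E)%E.
Proof.
move=> a0 b0 hA hB.
have B0 : 0 <= B by rewrite -lee_fin hB esum_ge0// => m _; rewrite lee_fin.
rewrite (_ : [set: int * int] = [set: int] `*`` (fun=> [set: int])); last first.
  by apply/seteqP; split.
rewrite -(@esum_esum _ _ _ _ _ (fun i j => (a i * b j)%:E))//; last first.
  by move=> i j _ _; rewrite lee_fin mulr_ge0.
rewrite mulrC EFinM hA -esum_intZl//.
apply: eq_esum => i _; rewrite muleC hB -esum_intZl//.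
Qed.

(** Pairs with even difference are the [(j + l, j - l)], those with odd difference the
    [(j + l + 1, j - l)], each for exactly one [(j, l)]. *)
Lemma esum_int2_parity (f : int * int -> \bar R) : (forall k, 0 <= f k)%E ->
  (\esum_(k in [set: int * int]) f k =
   \esum_(k in [set: int * int]) f (k.1 + k.2, k.1 - k.2)%R +
   \esum_(k in [set: int * int]) f (k.1 + k.2 + 1, k.1 - k.2)%R)%E.
Proof.
move=> f0.
pose ev (k : int * int) := ((k.1 + k.2)%R, (k.1 - k.2)%R).
pose od (k : int * int) := ((k.1 + k.2 + 1)%R, (k.1 - k.2)%R).
rewrite (esumID (range ev))//= !setTI.
have -> : ~` range ev = range od.
  apply/seteqP; split => [[m n] /= h|_ [[i j] _ <-] [[k l] _]]; last first.
    by rewrite /ev /od /= => -[]; lia.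
  have e := divz_eq (m - n) 2; have r0 := modz_ge0 (m - n) (isT : 2%:Z != 0).
  have r2 := ltz_pmod (m - n) (isT : 0 < 2%:Z).
  set l := ((m - n) %/ 2)%Z in e; set r := ((m - n) %% 2)%Z in e r0 r2.
  have [r00|r1] : r = 0 \/ r = 1 by lia.
    by exfalso; apply: h; exists (n + l, l) => //; rewrite /ev/=; congr pair; lia.
  by exists (n + l, l) => //; rewrite /od/=; congr pair; lia.
rewrite !esum_image// => -[i j] [k l] _ _; rewrite /ev /od /= => -[h1 h2];
  by congr pair; lia.
Qed.

(** By the parallelogram law the two squared angles add up to twice the squares of their half sum
    and half difference, hence the coupling [2 * K]. The even class of [esum_int2_parity] yields the
    angles [p + 2 * pi * j] and [q + 2 * pi * l]; the odd class shifts both by [pi]. *)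
Lemma villain_weight_even_odd K p q : 0 < K ->
  villain_weight K (p + q) * villain_weight K (p - q) =
  villain_weight (2 * K) p * villain_weight (2 * K) q +
  villain_weight (2 * K) (p + pi) * villain_weight (2 * K) (q + pi).
Proof.
move=> K0; have K20 : 0 < 2 * K by rewrite mulr_gt0.
have prodE L phi psi : 0 < L -> ((villain_weight L phi * villain_weight L psi)%:E =
    \esum_(k in [set: int * int])
      (villain_term L phi k.1 * villain_term L psi k.2)%:E)%E.
  move=> L0; exact: (esum_int_prod (villain_term_ge0 L phi)
    (villain_term_ge0 L psi) (villain_weightE _ L0) (villain_weightE _ L0)).
apply: EFin_inj; rewrite EFinD !prodE//.
rewrite esum_int2_parity; last by move=> k; rewrite lee_fin mulr_ge0 ?villain_term_ge0.
congr (_ + _)%E; apply: eq_esum => -[j l] _ /=; congr _%:E;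
  rewrite /villain_term -!expRD; congr expR; by rewrite !rmorphD/= rmorphN/=; field.
Qed.

End VillainWeight.

(** * Gaussian convolution and comparison of two couplings *)

Section Gauss.
Variable R : realType.
Implicit Types (K phi : R) (m : int).
Local Notation mu := (@lebesgue_measure R).

Let measurable_term K phi s m :
  measurable_fun [set: R] (fun a => villain_term K (phi + s * a) m).
Proof.
apply: measurableT_comp => //=; apply: measurable_funM => //=.
apply: measurable_funX; apply: measurable_funD => //.
by apply: measurable_funD => //; exact: measurable_funM.
Qed.

(** A Gaussian stays Gaussian under Gaussian convolution and becomes wider, so its coupling drops.
    The kernel and the constant depend neither on [m] nor on the sign [s], so the identity can be
    summed over [m] and symmetrised. *)
Lemma gauss_convolution K K' : 0 < K -> K < K' ->
  exists (g : R -> R) (c : R),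
  [/\ 0 < c, forall a, 0 <= g a, measurable_fun [set: R] g &
   forall phi s m, s ^+ 2 = 1 ->
   (\int[mu]_a (g a * villain_term K' (phi + s * a) m)%:E =
    (c * villain_term K phi m)%:E)%E].
Proof.
move=> K0 KK'; have K'0 : 0 < K' := lt_trans K0 KK'.
have d0 : 0 < K' - K by rewrite subr_gt0.
(* 1/K = 1/K' + 1/L: the variances of the Gaussians add up. *)
pose L := K * K' / (K' - K).
have L0 : 0 < L by rewrite divr_gt0// mulr_gt0.
have M0 : 0 < K' + L by rewrite addr_gt0.
pose sigma := Num.sqrt (K' + L)^-1.
have sig0 : sigma != 0 by rewrite gt_eqF// sqrtr_gt0 invr_gt0.
have sig2 : sigma ^+ 2 = (K' + L)^-1 by rewrite sqr_sqrtr// invr_ge0 ltW.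
have peak0 := normal_peak_gt0 sig0.
exists (fun a => expR (- (L / 2) * a ^+ 2)), (normal_peak sigma)^-1; split.
- by rewrite invr_gt0.
- by move=> a; rewrite expR_ge0.
- by apply: measurableT_comp => //=; apply: measurable_funM => //.
move=> phi s m s2.
set psi := phi + 2 * pi * m%:~R.
(* Completing the square in [a], with [s ^ 2 = 1]: the total exponent is that of a normal density of
   mean [m'] and variance [(K' + L)^-1], plus [- (K / 2) * psi ^ 2]. *)
pose m' := - (s * K' * psi / (K' + L)).
have E a : expR (- (L / 2) * a ^+ 2) * villain_term K' (phi + s * a) m =
    ((normal_peak sigma)^-1 * villain_term K phi m) * normal_pdf m' sigma a.
  rewrite normal_pdfE//= mulrACA mulVf ?gt_eqF// mul1r /normal_fun.
  rewrite /villain_term -/psi -!expRD; congr expR.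
  rewrite sig2 mulr2n.
  have -> : phi + s * a + 2 * pi * m%:~R = psi + s * a by rewrite /psi; ring.
  have KL : K * (K' + L) = K' * L.
    by rewrite /L; field; rewrite gt_eqF//.
  have iK : ((K' + L)^-1 + (K' + L)^-1)^-1 = (K' + L) / 2.
    by rewrite -mulr2n -[X in X^-1]mulr_natr invfM invrK.
  rewrite iK /m'.
  have -> : K = K' * L / (K' + L) by rewrite -KL mulfK// gt_eqF.
  have -> : - (K' / 2) * (psi + s * a) ^+ 2 =
      - (K' / 2) * (psi ^+ 2 + 2 * s * psi * a + s ^+ 2 * a ^+ 2) by ring.
  rewrite opprK.
  have -> : - (a + s * K' * psi / (K' + L)) ^+ 2 =
     - (a ^+ 2 + 2 * s * K' * psi / (K' + L) * a +
        s ^+ 2 * (K' * psi / (K' + L)) ^+ 2) by ring.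
  rewrite s2 !mul1r; field.
  by rewrite gt_eqF.
under eq_integral do rewrite E EFinM.
rewrite ge0_integralZl//.
- by rewrite integral_normal_pdf mule1.
- by apply/measurable_EFinP; exact: measurable_normal_pdf.
- by move=> a _; rewrite lee_fin normal_pdf_ge0.
- by rewrite lee_fin mulr_ge0 ?invr_ge0 ?normal_peak_ge0 ?villain_term_ge0.
Qed.

(** The identity for single terms is summed over [m]; sum and integral are exchanged because all
    terms are nonnegative. *)
Lemma villain_weight_convolution K K' : 0 < K -> K < K' ->
  exists (g : R -> R) (c : R),
  [/\ 0 < c, forall a, 0 <= g a &
   forall phi s, s ^+ 2 = 1 ->
   mu.-integrable [set: R]
     (EFin \o (fun a => g a * villain_weight K' (phi + s * a))) /\
   \int[mu]_a (g a * villain_weight K' (phi + s * a)) = c * villain_weight K phi].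
Proof.
move=> K0 KK'; have K'0 : 0 < K' := lt_trans K0 KK'.
have [g [c [c0 g0 mg gE]]] := gauss_convolution K0 KK'.
exists g, c; split => // phi s s2.
pose f m a := (g a * villain_term K' (phi + s * a) m)%:E.
have f0 m a : (0 <= f m a)%E by rewrite lee_fin mulr_ge0 ?villain_term_ge0.
have mf m : measurable_fun [set: R] (f m).
  by apply/measurable_EFinP; apply: measurable_funM => //; exact: measurable_term.
have fE : EFin \o (fun a => g a * villain_weight K' (phi + s * a)) =
    (fun a => \sum_(0 <= k <oo) (f (Posz k) a + f (Negz k) a))%E.
  apply/funext => a /=; rewrite EFinM villain_weightE// -esum_intZl//; last first.
    by move=> m; rewrite lee_fin villain_term_ge0.
  by rewrite esum_int// => m; rewrite mule_ge0// lee_fin ?villain_term_ge0.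
have mF k : measurable_fun [set: R] (fun a => (f (Posz k) a + f (Negz k) a)%E).
  exact: emeasurable_funD.
have F0 k x : (0 <= f (Posz k) x + f (Negz k) x)%E by rewrite adde_ge0.
have intf m : (\int[mu]_a f m a = (c * villain_term K phi m)%:E)%E by exact: gE.
have int_f : (\int[mu]_a (g a * villain_weight K' (phi + s * a))%:E =
    (c * villain_weight K phi)%:E)%E.
  rewrite -[LHS]/(integral mu [set: R]
     (EFin \o (fun a => g a * villain_weight K' (phi + s * a)))) fE.
  rewrite (integral_nneseries mu measurableT mF (fun k x _ => F0 k x)).
  transitivity (\sum_(0 <= k <oo) ((c * villain_term K phi (Posz k))%:E +
      (c * villain_term K phi (Negz k))%:E))%E.
    apply: eq_eseriesr => k _;
    rewrite (ge0_integralD mu measurableT (fun x _ => f0 (Posz k) x) (mf _)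
      (fun x _ => f0 (Negz k) x) (mf _)).
    by congr (_ + _)%E; exact: intf.
  transitivity (\esum_(m in [set: int]) (c * villain_term K phi m)%:E)%E.
    rewrite esum_int// => m; rewrite lee_fin mulr_ge0 ?villain_term_ge0//.
    exact: ltW.
  under eq_esum do rewrite EFinM.
  rewrite esum_intZl ?ltW//; last by move=> m; rewrite lee_fin villain_term_ge0.
  by rewrite EFinM villain_weightE.
split; last by rewrite /Rintegral int_f.
apply/integrableP; split.
  rewrite fE.
  by apply: ge0_emeasurable_sum => [k x _ _|k _]; [exact: F0|exact: mF].
under eq_integral do rewrite /= ger0_norm ?mulr_ge0 ?villain_weight_ge0//.
by rewrite int_f ltry.
Qed.

Lemma Rintegral_lincomb (l : seq (R * R)) (h : R -> R -> R) (I : R -> R) :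
  (forall phi, mu.-integrable [set: R] (EFin \o h phi)) ->
  (forall phi, \int[mu]_a h phi a = I phi) ->
  mu.-integrable [set: R] (EFin \o (fun a => \sum_(p <- l) p.1 * h p.2 a)) /\
  \int[mu]_a (\sum_(p <- l) p.1 * h p.2 a) = \sum_(p <- l) p.1 * I p.2.
Proof.
move=> ih hI; elim: l => [|p l [IH1 IH2]].
  rewrite big_nil (_ : (fun a => _) = fun=> 0); last first.
    by apply/funext => a; rewrite big_nil.
  by rewrite Rintegral_cst// mul0r; split => //; exact: integrable0.
have ip : mu.-integrable [set: R] (EFin \o (fun a => p.1 * h p.2 a)).
  by have := integrableZl measurableT p.1 (ih p.2).
rewrite big_cons.
rewrite (_ : (fun a => _) = (fun a => p.1 * h p.2 a + \sum_(j <- l) j.1 * h j.2 a)).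
  split; first by have := integrableD measurableT ip IH1.
  by rewrite RintegralD// IH2 RintegralZl// hI.
by apply/funext => a; rewrite big_cons.
Qed.

(** Multiplying the hypothesis by the kernel [g a >= 0] and integrating over [a] turns each
    symmetrised translate of the weight at [K'] into [2 * c] times the weight at [K]. *)
Lemma villain_weight_average K K' (l : seq (R * R)) : 0 < K -> K < K' ->
  (forall a, 0 <= \sum_(p <- l) p.1 *
      (villain_weight K' (p.2 + a) + villain_weight K' (p.2 - a))) ->
  0 <= \sum_(p <- l) p.1 * villain_weight K p.2.
Proof.
move=> K0 KK' H.
have [g [c [c0 g0 gE]]] := villain_weight_convolution K0 KK'.
have m1 : (-1) ^+ 2 = 1 :> R by rewrite sqrrN expr1n.
pose h phi a := g a * villain_weight K' (phi + 1 * a) +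
                g a * villain_weight K' (phi + (-1) * a).
have ih phi : mu.-integrable [set: R] (EFin \o h phi).
  have [i1 _] := gE phi 1 (expr1n _ _); have [i2 _] := gE phi (-1) m1.
  by have := integrableD measurableT i1 i2.
have hI phi : \int[mu]_a h phi a = 2 * c * villain_weight K phi.
  have [i1 e1] := gE phi 1 (expr1n _ _); have [i2 e2] := gE phi (-1) m1.
  by rewrite RintegralD// e1 e2; ring.
have [_] := Rintegral_lincomb l ih hI.
under [X in _ = X]eq_bigr do rewrite mulrCA.
rewrite -mulr_sumr => e.
have : 0 <= \int[mu]_a (\sum_(p <- l) p.1 * h p.2 a).
  apply: Rintegral_ge0 => a _.
  rewrite (_ : \sum_(p <- l) _ = g a * \sum_(p <- l) p.1 *
      (villain_weight K' (p.2 + a) + villain_weight K' (p.2 - a))).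
    exact: mulr_ge0.
  rewrite mulr_sumr; apply: eq_bigr => p _.
  by rewrite /h mul1r mulN1r; ring.
by rewrite e pmulr_rge0// mulr_gt0.
Qed.

End Gauss.

(** * Sums over grid configurations *)

(** The sum of the two equations exhibits the even number [2 * (j - j')] as [A + B] times an odd
    one. The ranges give [|A + B| < 2] and parity excludes 1 and -1, so [j = j']; then [k - k'] is a
    multiple of [2 * n + 1] too small to be nonzero. *)
Lemma odd_rotation_inj (n j j' k k' A B : int) :
  0 <= j <= 2 * n -> 0 <= j' <= 2 * n -> 0 <= k <= 2 * n -> 0 <= k' <= 2 * n ->
  j + k - (j' + k') = A * (2 * n + 1) -> j - k - (j' - k') = B * (2 * n + 1) ->
  j = j' /\ k = k'.
Proof.
move=> hj hj' hk hk' eA eB.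
have eS : 2 * (j - j') = (A + B) * (2 * n + 1) by rewrite [RHS]mulrDl -eA -eB; lia.
have S2 : A + B < 2 by nia.
have S1 : - 2 < A + B by nia.
have S0 : A + B = 0.
  have [//|[]] : A + B = 0 \/ A + B = 1 \/ A + B = -1 by lia.
  - by move=> e; rewrite e in eS; lia.
  - by move=> e; rewrite e in eS; lia.
rewrite S0 mul0r in eS.
have ejj : j = j' by lia.
subst j'; split => //.
have A1 : A < 1 by nia.
have A2 : - 1 < A by nia.
have A0 : A = 0 by lia.
by rewrite A0 in eA; lia.
Qed.

Section Grid.
Variables (R : realType) (V : choiceType).
Implicit Types (theta sigma delta : V -> R) (s : seq V) (n : nat).

Definition upd theta (x : V) (t : R) : V -> R := [eta theta with x |-> t].

Lemma updE theta x t y : upd theta x t y = if y == x then t else theta y.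
Proof. by []. Qed.

Lemma upd_upd theta x t u : upd (upd theta x t) x u = upd theta x u.
Proof. by apply/funext => y; rewrite !updE; case: eqP. Qed.

Lemma updC theta x y t u : x != y ->
  upd (upd theta x t) y u = upd (upd theta y u) x t.
Proof.
move=> xy; apply/funext => z; rewrite !updE.
by case: eqP => // ->; rewrite eq_sym (negPf xy).
Qed.

Lemma upd_addfun sigma delta x t u :
  upd (sigma \+ delta) x (t + u) = upd sigma x t \+ upd delta x u.
Proof. by apply/funext => y; rewrite /= !updE; case: eqP. Qed.

Lemma upd_subfun sigma delta x t u :
  upd (sigma \- delta) x (t - u) = upd sigma x t \- upd delta x u.
Proof. by apply/funext => y; rewrite /= !updE; case: eqP. Qed.

Definition periodic2pi (f : R -> R) : Prop :=
  forall a (k : int), f (a + 2 * pi * k%:~R) = f a.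

Definition mesh n : R := 2 * pi / (n.*2.+1)%:R.

(** Centring at [n] makes the grid symmetric about 0, a subgroup of the circle modulo [2 * pi], and
    the set of midpoints of the [n.*2.+1] equal cells of [[- pi, pi[]. *)
Definition gridpt n (j : 'I_n.*2.+1) : R := mesh n * (j%:R - n%:R).

Lemma mesh_period n : mesh n * (n.*2.+1)%:R = 2 * pi.
Proof. by rewrite /mesh divfK// pnatr_eq0. Qed.

Lemma natr_odd n : (n.*2.+1)%:R = 2 * n%:R + 1 :> R.
Proof. by rewrite -addn1 -muln2 natrD natrM mulrC. Qed.

Lemma gridpt_inZp n (m : nat) :
  exists k : int, mesh n * (m%:R - n%:R) = gridpt (inZp m : 'I_n.*2.+1) + 2 * pi * k%:~R.
Proof.
exists (m %/ n.*2.+1)%N; rewrite -(mesh_period n) /gridpt /=.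
rewrite {1}(divn_eq m n.*2.+1) natrD natrM -[X in _ + _ * X]/((m %/ n.*2.+1)%:R).
ring.
Qed.

Lemma sum_gridpt_pair n (g : R -> R -> R) :
  (forall b, periodic2pi (g^~ b)) -> (forall a, periodic2pi (g a)) ->
  \sum_(j < n.*2.+1) \sum_(k < n.*2.+1) g (gridpt j) (gridpt k) =
  \sum_(j < n.*2.+1) \sum_(k < n.*2.+1) g (gridpt j + gridpt k) (gridpt j - gridpt k).
Proof.
move=> per1 per2; rewrite !pair_big /=.
pose N := n.*2.+1.
(* Indices of the sum and difference of two grid points, recentred by [n]. One full period [N] is
   added to keep them natural numbers; periodicity removes it at the end. *)
pose h (p : 'I_N * 'I_N) : 'I_N * 'I_N :=
  (inZp (p.1 + p.2 + n.+1), inZp (p.1 + (N - p.2) + n)).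
have h_inj : injective h.
  move=> [j k] [j' k'] /= [] /eqP + /eqP.
  set a := (j + k + n.+1)%N; set a' := (j' + k' + n.+1)%N.
  set b := (j + (N - k) + n)%N; set b' := (j' + (N - k') + n)%N.
  move=> /eqP ea /eqP eb.
  have [] : Posz j = Posz j' /\ Posz k = Posz k'.
    have eN : Posz N = 2 * Posz n + 1 by rewrite /N -addn1 -muln2 PoszD PoszM mulrC.
    have key (u u' : nat) : u = u' %[mod N] -> Posz u - Posz u' =
        (Posz (u %/ N) - Posz (u' %/ N)) * (2 * Posz n + 1).
      move=> euu; rewrite {1}(divn_eq u N) {1}(divn_eq u' N) euu -eN.
      by rewrite !PoszD !PoszM; ring.
    have bound (i : 'I_N) : 0 <= Posz i <= 2 * Posz n.
      by rewrite lez_nat leq0n/= -PoszM lez_nat mul2n -ltnS.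
    apply: (@odd_rotation_inj (Posz n) _ _ _ _ _ _ _ _ _ _ (etrans _ (key _ _ ea))
      (etrans _ (key _ _ eb))) => //.
      by rewrite /a /a' !PoszD; ring.
    rewrite /b /b' !PoszD -!subzn ?(ltnW (ltn_ord _))//; ring.
  by move=> [] /val_inj -> [] /val_inj ->.
rewrite [LHS](reindex_inj h_inj) /=; apply: eq_bigr => -[j k] _ /=.
have [k1 e1] := gridpt_inZp n (j + k + n.+1).
have [k2 e2] := gridpt_inZp n (j + (N - k) + n).
rewrite -(per1 _ _ k1) -e1 -(per2 _ _ k2) -e2.
have -> : mesh n * ((j + k + n.+1)%:R - n%:R) = gridpt j + gridpt k + 2 * pi * 1%:~R.
  by rewrite -(mesh_period n) /gridpt natr_odd !natrD -(addn1 n) natrD mulr1z; ring.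
have -> : mesh n * ((j + (N - k) + n)%:R - n%:R) = gridpt j - gridpt k + 2 * pi * 1%:~R.
  rewrite -(mesh_period n) /gridpt !natrD natrB ?(ltnW (ltn_ord _))// natr_odd.
  by rewrite mulr1z; ring.
by rewrite per1 per2.
Qed.

(** Translation by a multiple of the mesh permutes the grid modulo [2 * pi]. *)
Lemma sum_gridpt_shift n (f : R -> R) (i : int) : periodic2pi f ->
  \sum_(j < n.*2.+1) f (mesh n * i%:~R + gridpt j) = \sum_(j < n.*2.+1) f (gridpt j).
Proof.
move=> perf; pose N := n.*2.+1.
pose r := `|(i %% Posz N)%Z|%N; pose q := (i %/ Posz N)%Z.
have ei : i = q * Posz N + Posz r.
  by rewrite {1}(divz_eq i N) /r gez0_abs// modz_ge0.
pose h (j : 'I_N) : 'I_N := inZp (j + r).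
have h_inj : injective h.
  move=> j k /(congr1 val)/= /eqP; rewrite eqn_modDr => /eqP.
  by rewrite !modn_small// => /val_inj.
rewrite [RHS](reindex_inj h_inj); apply: eq_bigr => j _ /=.
have [k e] := gridpt_inZp n (j + r).
rewrite /h -[RHS](perf _ k) -e -[RHS](perf _ q); congr f.
rewrite {1}ei /gridpt -(mesh_period n) rmorphD rmorphM/= natrD.
rewrite -[(Posz N)%:~R]/(N%:R) -[(Posz r)%:~R]/(r%:R) /N; ring.
Qed.

Lemma gridpt_rev n (j : 'I_n.*2.+1) : gridpt (rev_ord j) = - gridpt j.
Proof.
by rewrite /gridpt /= natrB ?ltn_ord// natr_odd -natr1; ring.
Qed.

Fixpoint configs n s theta : seq (V -> R) :=
  if s is x :: s' then
    flatten [seq configs n s' (upd theta x (gridpt j)) | j <- enum 'I_n.*2.+1]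
  else [:: theta].

Lemma big_configs_cons n x s theta (F : (V -> R) -> R) :
  \sum_(c <- configs n (x :: s) theta) F c =
  \sum_(j < n.*2.+1) \sum_(c <- configs n s (upd theta x (gridpt j))) F c.
Proof. by rewrite /= big_flatten big_map big_enum. Qed.

Lemma big_configs_nil n theta (F : (V -> R) -> R) :
  \sum_(c <- configs n [::] theta) F c = F theta.
Proof. by rewrite big_seq1. Qed.

Definition config_periodic (F : (V -> R) -> R) : Prop :=
  forall theta x, periodic2pi (fun t => F (upd theta x t)).

Lemma config_periodic_sum n s (F : (V -> R) -> R) : config_periodic F ->
  config_periodic (fun theta => \sum_(c <- configs n s theta) F c).
Proof.
move=> perF; elim: s => [|y s IH] theta x t k.
  by rewrite !big_configs_nil perF.
rewrite !big_configs_cons; apply: eq_bigr => j _.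
by have [->|xy] := eqVneq x y; [rewrite !upd_upd|rewrite !(updC _ _ _ xy) IH].
Qed.

Lemma sum_configs2_cons n x s theta theta' (H : (V -> R) -> (V -> R) -> R) :
  \sum_(c <- configs n (x :: s) theta) \sum_(c' <- configs n (x :: s) theta') H c c' =
  \sum_(j < n.*2.+1) \sum_(k < n.*2.+1)
    \sum_(c <- configs n s (upd theta x (gridpt j)))
    \sum_(c' <- configs n s (upd theta' x (gridpt k))) H c c'.
Proof.
rewrite big_configs_cons; apply: eq_bigr => j _.
by rewrite [RHS]exchange_big /=; apply: eq_bigr => c _; rewrite big_configs_cons.
Qed.

(* The map (sigma, delta) |-> (sigma + delta, sigma - delta) permutes pairs of
   grid configurations modulo 2 pi because the grid has an odd number of points. *)
Lemma sum_configs2_rotate n s (H : (V -> R) -> (V -> R) -> R) sigma delta :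
  (forall c', config_periodic (H^~ c')) -> (forall c, config_periodic (H c)) ->
  \sum_(c <- configs n s (sigma \+ delta)) \sum_(c' <- configs n s (sigma \- delta))
     H c c' =
  \sum_(c <- configs n s sigma) \sum_(c' <- configs n s delta)
     H (c \+ c') (c \- c').
Proof.
move=> per1 per2; elim: s sigma delta => [|x s IH] sigma delta.
  by rewrite !big_configs_nil.
rewrite !sum_configs2_cons.
rewrite (@sum_gridpt_pair n (fun t u =>
  \sum_(c <- configs n s (upd (sigma \+ delta) x t))
  \sum_(c' <- configs n s (upd (sigma \- delta) x u)) H c c')); first last.
- move=> a t k; apply: eq_bigr => c _.
  exact: (config_periodic_sum _ _ (per2 c)).
- move=> b; apply: (@config_periodic_sum n s (fun c =>
    \sum_(c' <- configs n s (upd (sigma \- delta) x b)) H c c')).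
  by move=> theta y t k; apply: eq_bigr => c' _; exact: per1.
apply: eq_bigr => j _; apply: eq_bigr => k _.
by rewrite upd_addfun upd_subfun IH.
Qed.

Lemma configs_grid n s theta c v : c \in configs n s theta ->
  (forall w, exists i : int, theta w = mesh n * i%:~R) ->
  exists i : int, c v = mesh n * i%:~R.
Proof.
elim: s theta => [|x s IH] theta; first by rewrite mem_seq1 => /eqP -> H; exact: H.
move=> /flattenP[_ /mapP[j _ ->] cj] H; apply: (IH _ cj) => w.
rewrite updE; case: eqP => // _.
by exists (Posz j - Posz n); rewrite /gridpt rmorphB.
Qed.

End Grid.

(** * Ginibre's inequality on the grid *)

Section Ginibre.
Variables (R : realType) (V : choiceType).
Implicit Types (theta sigma delta c : V -> R) (s : seq V) (n : nat) (e : {fset V}).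

Lemma edge_diffD sigma delta e :
  edge_diff (sigma \+ delta) e = edge_diff sigma e + edge_diff delta e.
Proof.
rewrite /edge_diff; case: (enum_fset e) => [|u [|v [|w l]]]; rewrite ?addr0//=.
ring.
Qed.

Lemma edge_diffB sigma delta e :
  edge_diff (sigma \- delta) e = edge_diff sigma e - edge_diff delta e.
Proof.
rewrite /edge_diff; case: (enum_fset e) => [|u [|v [|w l]]]; rewrite ?subr0//=.
ring.
Qed.

Lemma edge_diff_grid n c e : (forall v, exists i : int, c v = mesh R n * i%:~R) ->
  exists i : int, edge_diff c e = mesh R n * i%:~R.
Proof.
move=> H; rewrite /edge_diff; case: (enum_fset e) => [|u [|v [|w l]]];
  try by exists 0; rewrite mulr0.
have [i ->] := H u; have [j ->] := H v.
by exists (i - j); rewrite rmorphB/= mulrBr.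
Qed.

Lemma upd_shift theta x t (k : int) : exists b : V -> int,
  upd theta x (t + 2 * pi * k%:~R) =
  upd theta x t \+ (fun v => 2 * pi * (b v)%:~R).
Proof.
exists (fun v => if v == x then k else 0); apply/funext => v /=.
by rewrite !updE; case: eqP => //; rewrite mulr0 addr0.
Qed.

Lemma edge_diff_periodic (f : R -> R) e : periodic2pi f ->
  config_periodic (fun c => f (edge_diff c e)).
Proof.
move=> perf theta x t k; have [b ->] := upd_shift theta x t k.
rewrite edge_diffD.
have [i ->] : exists i : int,
    edge_diff (fun v => 2 * pi * (b v)%:~R) e = 2 * pi * i%:~R :> R.
  rewrite /edge_diff; case: (enum_fset e) => [|u [|v [|w l]]];
    try by exists 0; rewrite mulr0.
  by exists (b u - b v); rewrite rmorphB/= mulrBr.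
exact: perf.
Qed.

Lemma cos_periodic2pi : periodic2pi (@cos R).
Proof.
have pos a m : cos (a + 2 * pi * m%:R) = cos a :> R.
  rewrite -[RHS](periodicn (@cosD2pi R) m) -mulr_natr mulr2n.
  by congr cos; ring.
move=> a [m|m]; first exact: pos.
by rewrite NegzE rmorphN/= mulrN -[LHS](pos _ m.+1) subrK.
Qed.

Lemma diff_periodic (f : R -> R) (x y : V) : periodic2pi f ->
  config_periodic (fun c => f (c x - c y)).
Proof.
move=> perf theta z t k; have [b ->] := upd_shift theta z t k.
rewrite /= (_ : _ - _ = upd theta z t x - upd theta z t y +
   2 * pi * (b x - b y)%:~R); first exact: perf.
by rewrite rmorphB/=; ring.
Qed.

(* Membership in Ginibre's cone: the rotated product is a sum of terms
   [p sigma * p delta], whose double sums are squares. *)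
Definition splits (P : (V -> R) -> R) : Prop :=
  exists L : seq ((V -> R) -> R), forall sigma delta,
    P (sigma \+ delta) * P (sigma \- delta) = \sum_(p <- L) p sigma * p delta.

Lemma splits1 : splits (fun=> 1).
Proof. by exists [:: fun=> 1] => sigma delta; rewrite big_seq1. Qed.

Lemma splitsM P Q : splits P -> splits Q -> splits (fun c => P c * Q c).
Proof.
move=> [L hL] [M hM].
exists [seq (fun c => p c * q c) | p <- L, q <- M] => sigma delta.
rewrite mulrACA hL hM big_distrl/= big_allpairs_dep; apply: eq_bigr => p _.
by rewrite big_distrr/=; apply: eq_bigr => q _; rewrite mulrACA.
Qed.

Lemma splits_villain K e : 0 < K ->
  splits (fun c => villain_weight K (edge_diff c e)).
Proof.
move=> K0; exists [:: (fun c => villain_weight (2 * K) (edge_diff c e));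
   (fun c => villain_weight (2 * K) (edge_diff c e + pi))] => sigma delta.
by rewrite edge_diffD edge_diffB villain_weight_even_odd// big_cons big_seq1.
Qed.

Lemma villain_periodic K a : periodic2pi (fun phi => @villain_weight R K (phi + a)).
Proof. by move=> phi k; rewrite addrAC villain_weight_periodic. Qed.

Lemma config_periodicM (F G : (V -> R) -> R) : config_periodic F ->
  config_periodic G -> config_periodic (fun c => F c * G c).
Proof. by move=> pF pG theta x t k; rewrite pF pG. Qed.

(** With two copies of the configuration, twice the difference of the two sides is a double sum of
    [T], the product of two antisymmetric factors and the symmetric weight [P c * P c']. After
    rotation [T] becomes a positive combination of products [S c * S c'], and the double sum a sum
    of squares. *)
Lemma ginibre_translate K (P : (V -> R) -> R) e n s (x y : V) (a : R) : 0 < K ->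
  config_periodic P -> splits P ->
  (\sum_(c <- configs n s (fun=> 0)) P c * villain_weight K (edge_diff c e)) *
  (\sum_(c <- configs n s (fun=> 0)) cos (c x - c y) * P c *
    (villain_weight K (edge_diff c e + a) + villain_weight K (edge_diff c e - a))) <=
  (\sum_(c <- configs n s (fun=> 0)) cos (c x - c y) * P c *
    villain_weight K (edge_diff c e)) *
  (\sum_(c <- configs n s (fun=> 0)) P c *
    (villain_weight K (edge_diff c e + a) + villain_weight K (edge_diff c e - a))).
Proof.
move=> K0 perP [L hL].
set C := configs _ _ _.
pose F (c : V -> R) := cos (c x - c y).
pose v b c := villain_weight K (edge_diff c e + b).
pose w c := v a c + v (- a) c.
have v0 c : villain_weight K (edge_diff c e) = v 0 c by rewrite /v addr0.
under eq_bigr do rewrite v0.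
under [X in _ <= X * _]eq_bigr do rewrite v0 -/(F _).
under [X in _ * X <= _]eq_bigr do rewrite -/(F _) -/(w _).
under [X in _ <= _ * X]eq_bigr do rewrite -/(w _).
have perF : config_periodic F by exact: diff_periodic cos_periodic2pi.
have perv b : config_periodic (v b).
  exact: (edge_diff_periodic e (villain_periodic K b)).
have perw : config_periodic w by move=> theta z t k; rewrite /w !perv.
pose T c c' := (F c - F c') * (P c * P c') * (v 0 c * w c' - w c * v 0 c').
have TE : \sum_(c <- C) \sum_(c' <- C) T c c' =
    2 * ((\sum_(c <- C) F c * P c * v 0 c) * (\sum_(c <- C) P c * w c) -
    (\sum_(c <- C) P c * v 0 c) * (\sum_(c <- C) F c * P c * w c)).
  pose A1 c c' := F c * P c * v 0 c * (P c' * w c').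
  pose A2 c c' := P c * v 0 c * (F c' * P c' * w c').
  have -> : \sum_(c <- C) \sum_(c' <- C) T c c' =
     \sum_(c <- C) \sum_(c' <- C) (A1 c c' + A1 c' c - A2 c c' - A2 c' c).
    by apply: eq_bigr => c _; apply: eq_bigr => c' _; rewrite /T /A1 /A2; ring.
  have dist (f g : (V -> R) -> R) : (\sum_(c <- C) f c) * (\sum_(c <- C) g c) =
      \sum_(c <- C) \sum_(c' <- C) f c * g c'.
    by rewrite big_distrl/=; apply: eq_bigr => c _; rewrite big_distrr.
  rewrite !dist; under eq_bigr do rewrite !sumrB big_split/=.
  rewrite !sumrB big_split/= [X in _ + X - _ - _]exchange_big/=.
  by rewrite [X in _ - X = _]exchange_big/= /A1 /A2; ring.
suff : 0 <= \sum_(c <- C) \sum_(c' <- C) T c c'.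
  by rewrite TE pmulr_rge0// subr_ge0.
have C0 : (fun=> 0 : R) = (fun=> 0 : R) \+ (fun=> 0 : R) :> (V -> R).
  by apply/funext => z /=; rewrite addr0.
have C1 : (fun=> 0 : R) = (fun=> 0 : R) \- (fun=> 0 : R) :> (V -> R).
  by apply/funext => z /=; rewrite subr0.
have rot := @sum_configs2_rotate R V n s T (fun=> 0) (fun=> 0).
rewrite -C0 -C1 -/C in rot; rewrite {}rot; first last.
- by move=> c theta z t k; rewrite /T perF perP perw perv.
- by move=> c theta z t k; rewrite /T perF perP perw perv.
pose u b c := villain_weight (2 * K) (edge_diff c e + b).
(* Rotating the shifts [0] and [a] produces half-shifts by [a / 2], of which only the increments
   survive; [h] is 0 or [pi] according to the parity class. *)
pose Du h c := u (h + a / 2) c - u (h - a / 2) c.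
pose S h (p : (V -> R) -> R) c := sin (c x - c y) * p c * Du h c.
have TS c c' : T (c \+ c') (c \- c') =
    2 * \sum_(p <- L) (S 0 p c * S 0 p c' + S pi p c * S pi p c').
  rewrite /T hL.
  have -> : F (c \+ c') - F (c \- c') = - 2 * (sin (c x - c y) * sin (c' x - c' y)).
    rewrite /F /= (_ : c x + c' x - _ = (c x - c y) + (c' x - c' y)); last by ring.
    rewrite (_ : c x - c' x - _ = (c x - c y) - (c' x - c' y)); last by ring.
    by move: (c x - c y) (c' x - c' y) => A B; rewrite cosD cosB; ring.
  have vv b b' : v b (c \+ c') * v b' (c \- c') =
      u ((b + b') / 2) c * u ((b - b') / 2) c' +
      u (pi + (b + b') / 2) c * u (pi + (b - b') / 2) c'.
    rewrite /v edge_diffD edge_diffB.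
    rewrite (_ : edge_diff c e + _ + b =
      (edge_diff c e + (b + b') / 2) + (edge_diff c' e + (b - b') / 2)); last by field.
    rewrite (_ : edge_diff c e - _ + b' =
      (edge_diff c e + (b + b') / 2) - (edge_diff c' e + (b - b') / 2)); last by field.
    rewrite villain_weight_even_odd// /u.
    by congr (_ * _ + villain_weight _ _ * villain_weight _ _); rewrite -addrA (addrC _ pi).
  (* The four rotated products factor as minus a product of increments; this sign cancels the one of
     [- 2] coming from the cosines. *)
  have -> : v 0 (c \+ c') * w (c \- c') - w (c \+ c') * v 0 (c \- c') =
      - (Du 0 c * Du 0 c' + Du pi c * Du pi c').
    have h1 := vv 0 a; have h2 := vv 0 (- a).
    have h3 := vv a 0; have h4 := vv (- a) 0.
    rewrite !(add0r, sub0r, addr0, subr0, opprK, mulNr) in h1 h2 h3 h4.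
    rewrite /w mulrDr mulrDl h1 h2 h3 h4 /Du !add0r.
    move: (u _ c) (u _ c) (u _ c) (u _ c) => m1 m2 m3 m4.
    move: (u _ c') (u _ c') (u _ c') (u _ c') => m1' m2' m3' m4'.
    by ring.
  rewrite mulr_sumr mulr_suml mulr_sumr; apply: eq_bigr => p _.
  rewrite /S.
  move: (Du 0 c) (Du 0 c') (Du pi c) (Du pi c') (sin _) (sin _) (p c) (p c').
  by move=> d1 d2 d3 d4 s1 s2 p1 p2; ring.
under eq_bigr do under eq_bigr do rewrite TS.
have -> : \sum_(c <- C) \sum_(c' <- C)
    2 * \sum_(p <- L) (S 0 p c * S 0 p c' + S pi p c * S pi p c') =
   2 * \sum_(p <- L) ((\sum_(c <- C) S 0 p c) ^+ 2 + (\sum_(c <- C) S pi p c) ^+ 2).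
  under eq_bigr do rewrite -mulr_sumr exchange_big/=.
  rewrite -mulr_sumr exchange_big/=; congr (_ * _).
  apply: eq_bigr => p _; under eq_bigr do rewrite big_split/= -!mulr_sumr.
  by rewrite big_split/= -!mulr_suml.
rewrite mulr_ge0// sumr_ge0// => p _.
by rewrite addr_ge0// sqr_ge0.
Qed.

End Ginibre.

(** * From translates to averages, and grid sums on nested vertex sets *)

Section GinibreGrid.
Variables (R : realType) (V : choiceType).
Implicit Types (theta sigma delta c : V -> R) (s : seq V) (n : nat) (e : {fset V}).

(* Dual form of: on the grid of mesh n, w is a positive combination of the
   symmetrised translates of v. *)
Definition grid_average n (v w : R -> R) : Prop :=
  forall l : seq (R * R), (forall p, p \in l -> exists i : int, p.2 = mesh R n * i%:~R) ->
  (forall a, 0 <= \sum_(p <- l) p.1 * (v (p.2 + a) + v (p.2 - a))) ->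
  0 <= \sum_(p <- l) p.1 * w p.2.

Lemma grid_average_villain n K K' : 0 < K -> K < K' ->
  grid_average n (villain_weight K') (@villain_weight R K).
Proof. by move=> K0 KK' l _; exact: villain_weight_average. Qed.

(** The hypothesis is summed over [a] in the grid. As the nodes [p.2] lie on the grid, every
    translated sum equals the same [S > 0], and the total is [2 * S] times the conclusion. *)
Lemma grid_average_cst n K : 0 < K ->
  grid_average n (villain_weight K) (fun=> 1 : R).
Proof.
move=> K0 l lgrid H.
pose S : R := \sum_(j < n.*2.+1) villain_weight K (gridpt R j).
have S0 : 0 < S.
  rewrite /S big_ord_recl ltr_wpDr ?sumr_ge0// => [j _|].
    exact: villain_weight_ge0.
  exact: lt_le_trans (expR_gt0 _) (villain_weight_lb _ K0).
have shift (i : int) : \sum_(j < n.*2.+1) villain_weight K (mesh R n * i%:~R + gridpt R j) = S.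
  by apply: sum_gridpt_shift => phi k; rewrite villain_weight_periodic.
have shiftN (i : int) : \sum_(j < n.*2.+1) villain_weight K (mesh R n * i%:~R - gridpt R j) = S.
  rewrite -(shift i) (reindex_inj rev_ord_inj)/=; apply: eq_bigr => j _.
  by rewrite gridpt_rev opprK.
have : 0 <= \sum_(j < n.*2.+1) \sum_(p <- l) p.1 *
    (villain_weight K (p.2 + gridpt R j) + villain_weight K (p.2 - gridpt R j)).
  by apply: sumr_ge0 => j _; exact: H.
rewrite exchange_big/=.
have -> : \sum_(p <- l) \sum_(j < n.*2.+1) p.1 *
    (villain_weight K (p.2 + gridpt R j) + villain_weight K (p.2 - gridpt R j)) =
    2 * S * \sum_(p <- l) p.1 * 1.
  rewrite mulr_sumr; apply: eq_big_seq => p /lgrid[i ei].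
  by rewrite -mulr_sumr big_split/= ei shift shiftN; ring.
by rewrite pmulr_rge0// mulr_gt0.
Qed.

(** The difference of the two sides is linear in [w]: it is a combination of the values of [w] at
    the edge differences, with coefficients [P c * (N - Z * cos (c x - c y))]. Its nonnegativity for
    symmetrised translates, given by [ginibre_translate], thus carries over to their averages. *)
Lemma ginibre_grid K w (P : (V -> R) -> R) e n s (x y : V) : 0 < K ->
  grid_average n (villain_weight K) w -> config_periodic P -> splits P ->
  (\sum_(c <- configs n s (fun=> 0)) P c * villain_weight K (edge_diff c e)) *
  (\sum_(c <- configs n s (fun=> 0)) cos (c x - c y) * P c * w (edge_diff c e)) <=
  (\sum_(c <- configs n s (fun=> 0)) cos (c x - c y) * P c *
    villain_weight K (edge_diff c e)) *
  (\sum_(c <- configs n s (fun=> 0)) P c * w (edge_diff c e)).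
Proof.
move=> K0 avg perP spP; set C := configs _ _ _.
set Z := (X in X * _ <= _); set N := (X in _ <= X * _).
pose l := [seq (P c * (N - Z * cos (c x - c y)), edge_diff c e) | c <- C].
have lE (f : R -> R) : \sum_(p <- l) p.1 * f p.2 =
    N * (\sum_(c <- C) P c * f (edge_diff c e)) -
    Z * (\sum_(c <- C) cos (c x - c y) * P c * f (edge_diff c e)).
  rewrite /l big_map/= !mulr_sumr -sumrB; apply: eq_bigr => c _; ring.
rewrite -subr_ge0 -lE; apply: avg => [p /mapP[c cC ->] /=|a].
  apply: edge_diff_grid => v; apply: (@configs_grid R V n s (fun=> 0) c v cC) => u.
  by exists 0; rewrite mulr0.
rewrite (lE (fun phi => villain_weight K (phi + a) + villain_weight K (phi - a))).
by rewrite subr_ge0; exact: ginibre_translate.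
Qed.

Lemma sum_configs_rem n x s theta (F : (V -> R) -> R) : x \in s ->
  \sum_(c <- configs n s theta) F c =
  \sum_(c <- configs n (x :: rem x s) theta) F c.
Proof.
elim: s theta => [//|y s IH] theta; rewrite inE.
have [->|xy] := eqVneq x y; first by rewrite /= eqxx.
have -> : rem x (y :: s) = y :: rem x s by rewrite /= eq_sym (negPf xy).
move=> xs; rewrite !big_configs_cons.
under eq_bigr do rewrite IH// big_configs_cons.
under [RHS]eq_bigr do rewrite big_configs_cons.
rewrite exchange_big/=; apply: eq_bigr => k _; apply: eq_bigr => j _.
by rewrite updC// eq_sym.
Qed.

(** Each angle of [s] outside [s'] takes [n.*2.+1] values without affecting [F]; the others are
    matched one at a time, [sum_configs_rem] moving the head of [s'] to the front of [s]. *)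
Lemma sum_configs_subset n s s' theta (F : (V -> R) -> R) :
  uniq s -> uniq s' -> {subset s' <= s} ->
  (forall theta x t, x \in s -> x \notin s' -> F (upd theta x t) = F theta) ->
  \sum_(c <- configs n s theta) F c =
  (n.*2.+1)%:R ^+ (size s - size s') * \sum_(c <- configs n s' theta) F c.
Proof.
elim: s' s theta => [|x s' IH] s theta us us' sub indep.
  rewrite subn0 big_configs_nil; elim: s theta {us sub} indep => [|y s IHs] theta indep.
    by rewrite big_configs_nil mul1r.
  rewrite big_configs_cons.
  under eq_bigr => j _.
    rewrite IHs => [|theta' z t zs _]; last by rewrite indep// inE zs orbT.
    rewrite indep ?mem_head//; over.
  by rewrite sumr_const card_ord -[LHS]mulr_natl /= exprS mulrA.
have xs : x \in s by rewrite sub ?mem_head.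
move: us' => /= /andP[xs' us'].
rewrite (sum_configs_rem _ _ _ xs) !big_configs_cons mulr_sumr.
apply: eq_bigr => j _.
rewrite IH ?rem_uniq//.
- by rewrite size_rem// -subn1 -subnDA add1n.
- move=> z zs'; rewrite mem_rem_uniq// !inE sub ?inE ?zs' ?orbT// andbT.
  by apply: contraNneq xs' => <-.
- move=> theta' z t; rewrite mem_rem_uniq// !inE => /andP[zx zs] zs'.
  by rewrite indep// inE negb_or zx.
Qed.

End GinibreGrid.

(** * Riemann sums for the torus integral *)

Section RiemannSums.
Variable R : realType.
Local Notation mu := (@lebesgue_measure R).
Implicit Types (f : R -> R) (L a b h t u : R).

Definition lip L f : Prop := forall t u, `|f t - f u| <= L * `|t - u|.

Lemma lip_continuous L f : lip L f -> continuous f.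
Proof.
move=> Lf x; apply/cvgrPdist_le => /= eps eps0; near=> y.
apply: (le_trans (Lf x y)).
apply: (@le_trans _ _ ((`|L| + 1) * `|x - y|)).
  by rewrite ler_wpM2r// (le_trans (ler_norm L))// lerDl.
rewrite -ler_pdivlMl ?ltr_wpDl// mulrC.
near: y; apply: cvgr_dist_le => //.
by rewrite divr_gt0// ltr_wpDl.
Unshelve. all: by end_near. Qed.

Lemma lip_integrable L f a b : lip L f -> mu.-integrable `[a, b[ (EFin \o f).
Proof.
move=> Lf.
have ic : mu.-integrable `[a, b] (EFin \o f).
  apply: continuous_compact_integrable; first exact: segment_compact.
  by apply: continuous_subspaceT; exact: lip_continuous Lf.
by apply: integrableS ic => //; apply: subset_itvl; rewrite bnd_simp.
Qed.

Lemma Rintegral_itv_cst a b c : a <= b -> \int[mu]_(t in `[a, b[) c = c * (b - a).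
Proof.
move=> ab; rewrite Rintegral_cst//=  lebesgue_measure_itv/= lte_fin.
by case: ltgtP ab => //= -> _; rewrite subrr.
Qed.

Lemma Rintegral_cell L f a b t : 0 <= L -> lip L f -> a <= t <= b ->
  `|\int[mu]_(u in `[a, b[) f u - (b - a) * f t| <= L * (b - a) ^+ 2.
Proof.
move=> L0 Lf /andP[at_ tb]; have ab := le_trans at_ tb.
have lipg : lip L (fun u => f u - f t).
  by move=> u v; rewrite (_ : _ - _ = f u - f v) ?Lf//; ring.
have lipc (c : R) : lip 0 (fun=> c) by move=> u v; rewrite subrr normr0 mul0r.
have -> : \int[mu]_(u in `[a, b[) f u - (b - a) * f t =
    \int[mu]_(u in `[a, b[) (f u - f t).
  rewrite RintegralB//; first by rewrite Rintegral_itv_cst// mulrC.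
  - exact: lip_integrable Lf.
  - exact: lip_integrable (lipc _).
apply: (le_trans (le_normr_Rintegral _ (lip_integrable a b lipg))) => //.
apply: (@le_trans _ _ (\int[mu]_(u in `[a, b[) (L * (b - a)))); last first.
  by rewrite Rintegral_itv_cst// expr2 mulrA.
apply: le_Rintegral => //.
- apply: (@lip_integrable L) => u v.
  by rewrite (le_trans (ler_dist_dist _ _))// lipg.
- exact: lip_integrable (lipc _).
- move=> u /=; rewrite in_itv/= => /andP[au ub].
  rewrite (le_trans (Lf _ _))// ler_wpM2l// ler_norml; lra.
Qed.

Lemma Rintegral_cells L f a h k : 0 <= L -> lip L f -> 0 <= h ->
  `|\int[mu]_(u in `[a, a + h *+ k[) f u - h * \sum_(i < k) f (a + h * (i%:R + 2^-1))|
  <= k%:R * (L * h ^+ 2).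
Proof.
move=> L0 Lf h0; elim: k => [|k IH].
  by rewrite mulr0n addr0 set_itvco0 Rintegral_set0 big_ord0 mulr0 subrr normr0 mul0r.
have h1 : a <= a + h *+ k by rewrite lerDl mulrn_wge0.
have h2 : a + h *+ k <= a + h *+ k.+1 by rewrite lerD2l mulrS lerDr.
rewrite (@itv_bndbnd_setU _ _ _ (BLeft (a + h *+ k))) ?bnd_simp//.
rewrite Rintegral_setU//; last 2 first.
- rewrite -itv_bndbnd_setU ?bnd_simp//; exact: lip_integrable Lf.
- apply/disj_setPS => u [] /=; rewrite !in_itv/= => /andP[_ u1] /andP[u2 _].
  by have := lt_le_trans u1 u2; rewrite ltxx.
rewrite big_ord_recr/= mulrDr opprD addrACA (le_trans (ler_normD _ _))//.
rewrite -[k.+1]addn1 natrD mulrDl mul1r addn1 lerD//.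
have -> : h * f (a + h * (k%:R + 2^-1)) =
    ((a + h *+ k.+1) - (a + h *+ k)) * f (a + h * (k%:R + 2^-1)).
  by congr (_ * _); rewrite mulrS; ring.
have e : a + h *+ k.+1 - (a + h *+ k) = h by rewrite mulrS; ring.
rewrite -[X in _ <= _ * X ^+ 2]e.
apply: Rintegral_cell => //.
have -> : h * (k%:R + 2^-1) = h *+ k + h / 2 by rewrite mulrDr mulr_natr.
apply/andP; split; rewrite lerD2l; first by rewrite lerDl divr_ge0.
by rewrite [h *+ k.+1]mulrSr lerD2l ler_pdivrMr// ler_peMr// ler1n.
Qed.

(** The grid points are the midpoints of [n.*2.+1] cells; each cell contributes an error
    [L * mesh R n ^+ 2], and the cells have total length [2 * pi]. *)
Lemma Rintegral_midpoint L f n : 0 <= L -> lip L f ->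
  `|\int[mu]_(u in `[- pi, pi[) f u - mesh R n * \sum_(j < n.*2.+1) f (gridpt R j)|
  <= 2 * pi * L * mesh R n.
Proof.
move=> L0 Lf; have m0 : 0 <= mesh R n by rewrite divr_ge0// mulr_ge0// pi_ge0.
have := Rintegral_cells (- pi) n.*2.+1 L0 Lf m0.
have -> : - pi + mesh R n *+ n.*2.+1 = pi :> R.
  by rewrite -mulr_natr mesh_period; ring.
have e : \sum_(i < n.*2.+1) f (- pi + mesh R n * (i%:R + 2^-1)) =
    \sum_(j < n.*2.+1) f (gridpt R j).
  apply: eq_bigr => j _; congr f.
  have -> : - pi = - (mesh R n * (n.*2.+1)%:R) / 2 :> R by rewrite mesh_period; field.
  by rewrite /gridpt natr_odd; field.
rewrite e => h; apply: (le_trans h).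
rewrite -(mesh_period R n) le_eqVlt; apply/orP; left; apply/eqP; ring.
Qed.

End RiemannSums.

(** * Riemann sums for iterated integrals over the angles *)

Section AngleIntegral.
Variables (R : realType) (V : choiceType).
Local Notation mu := (@lebesgue_measure R).
Implicit Types (F : (V -> R) -> R) (L : R) (theta : V -> R) (s : seq V).

Definition config_lip L F : Prop :=
  forall theta x, lip L (fun t => F (upd theta x t)).

(** Each integration spreads the Lipschitz bound over an interval of length [2 * pi]. The result
    makes the midpoint estimate applicable to inner integrals. *)
Lemma angle_integral_lip L F s : 0 <= L -> config_lip L F ->
  config_lip ((2 * pi) ^+ size s * L) (angle_integral s F).
Proof.
move=> L0 LF; have pi0 := pi_gt0 R.
elim: s => [|y s IH] theta x t u; first by rewrite mul1r; exact: LF.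
rewrite [angle_integral]lock /= -lock.
have lipy z : lip ((2 * pi) ^+ size s * L)
    (fun r => angle_integral s F (upd (upd theta x z) y r)) by exact: IH.
have lipB : lip (2 * ((2 * pi) ^+ size s * L)) (fun r =>
    angle_integral s F (upd (upd theta x t) y r) -
    angle_integral s F (upd (upd theta x u) y r)).
  move=> r r'; set A := angle_integral _ _ _; set B := angle_integral _ _ _.
  set C := angle_integral _ _ _; set D := angle_integral _ _ _.
  rewrite (_ : _ - _ = (A - C) - (B - D)); last by ring.
  rewrite (le_trans (ler_normB _ _))// -mulrA mulr_natl mulr2n.
  by rewrite lerD// lipy.
have E : angle_integral (y :: s) F (upd theta x t) -
    angle_integral (y :: s) F (upd theta x u) =
    \int[mu]_(r in `[- pi, pi[) (angle_integral s F (upd (upd theta x t) y r) -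
      angle_integral s F (upd (upd theta x u) y r)).
  by rewrite RintegralB//; exact: lip_integrable (lipy _).
rewrite E; apply: (le_trans (le_normr_Rintegral _ (lip_integrable _ _ lipB))) => //.
have -> : (2 * pi) ^+ (size s).+1 * L * `|t - u| =
    \int[mu]_(r in `[- pi, pi[) ((2 * pi) ^+ size s * L * `|t - u|).
  by rewrite Rintegral_itv_cst ?exprS; [ring|lra].
apply: le_Rintegral => //.
- apply: (@lip_integrable _ (2 * ((2 * pi) ^+ size s * L))) => r r'.
  by rewrite (le_trans (ler_dist_dist _ _))// lipB.
- by apply: (@lip_integrable _ 0) => r r'; rewrite subrr normr0 mul0r.
(* If the varied angle is the one being integrated, its value is overwritten and the difference
   vanishes. *)
- move=> r _; have [<-|xy] := eqVneq x y.
    by rewrite !upd_upd subrr normr0 !mulr_ge0// exprn_ge0// mulr_ge0// ltW.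
  by rewrite !(updC _ _ _ xy); exact: IH.
Qed.

(** The outer integral is replaced by its midpoint sum, then each inner integral by its grid sum;
    every one of the [size s] replacements costs the same. *)
Lemma angle_integral_approx L F s n theta : 0 <= L -> config_lip L F ->
  `|angle_integral s F theta -
    mesh R n ^+ size s * \sum_(c <- configs n s theta) F c|
  <= (size s)%:R * (2 * pi) ^+ size s * L * mesh R n.
Proof.
move=> L0 LF; have pi0 := pi_gt0 R.
have m0 : 0 <= mesh R n by rewrite divr_ge0// mulr_ge0// ltW.
elim: s theta => [|x s IH] theta.
  by rewrite big_configs_nil mul1r subrr normr0 !mul0r.
rewrite big_configs_cons.
set k := (2 * pi) ^+ size s * L.
have k0 : 0 <= k by rewrite mulr_ge0// exprn_ge0// mulr_ge0// ltW.
pose I t := angle_integral s F (upd theta x t).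
have h1 := Rintegral_midpoint n k0 (angle_integral_lip s L0 LF theta x).
set A := \int[mu]_(u in `[- pi, pi[) _ in h1.
rewrite -[angle_integral (x :: s) F theta]/A.
set B := mesh R n * _ in h1.
rewrite -(subrKA B) (le_trans (ler_normD _ _))//.
apply: (@le_trans _ _ (2 * pi * k * mesh R n + 2 * pi * ((size s)%:R * k * mesh R n))).
  apply: lerD => //; rewrite /B exprS -mulrA -mulrBr mulr_sumr -sumrB normrM ger0_norm//.
  rewrite -(mesh_period R n) -mulrA ler_wpM2l//.
  apply: (le_trans (ler_norm_sum _ _ _)).
  rewrite mulr_natl -[X in _ *+ X](card_ord n.*2.+1) -sumr_const.
  by apply: ler_sum => j _; rewrite /k mulrA; exact: IH.
rewrite /k [size (x :: s)]/= exprS -natr1 le_eqVlt; apply/orP; left; apply/eqP; ring.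
Qed.

Lemma mesh_cvg0 : mesh R n @[n --> \oo] --> (0 : R).
Proof.
have h : (2 * pi) * harmonic n @[n --> \oo] --> (2 * pi * 0 : R).
  by apply: cvgMr => //; exact: cvg_harmonic.
rewrite mulr0 in h; apply: squeeze_cvgr (@cvg_cst _ 0 _ _ _) h; apply: nearW => n.
rewrite /mesh divr_ge0 ?mulr_ge0 ?pi_ge0//= ler_wpM2l ?mulr_ge0 ?pi_ge0//.
by rewrite /= lef_pV2 ?posrE ?ltr0n// ler_nat ltnS -addnn leq_addr.
Qed.

Lemma cvg_riemann L F s theta : 0 <= L -> config_lip L F ->
  mesh R n ^+ size s * \sum_(c <- configs n s theta) F c @[n --> \oo] -->
  angle_integral s F theta.
Proof.
move=> L0 LF; apply/cvgrPdist_le => eps eps0.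
set C := (size s)%:R * (2 * pi) ^+ size s * L.
have C0 : 0 <= C by rewrite !mulr_ge0// exprn_ge0// mulr_ge0// pi_ge0.
have /cvgrPdist_le H := mesh_cvg0.
have e1 : 0 < eps / (C + 1) by rewrite divr_gt0// ltr_wpDl.
near=> n; apply: (le_trans (angle_integral_approx _ _ _ L0 LF)).
rewrite -/C.
have : mesh R n <= eps / (C + 1).
  have : `|0 - mesh R n| <= eps / (C + 1) by near: n; exact: H.
  by rewrite sub0r normrN; apply: le_trans; exact: ler_norm.
rewrite ler_pdivlMr ?ltr_wpDl// => h.
apply: le_trans h; rewrite mulrC ler_wpM2l ?lerDl//.
by rewrite divr_ge0// mulr_ge0// pi_ge0.
Unshelve. all: by end_near. Qed.

End AngleIntegral.

(** * Monotonicity of correlations *)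

Section NiceWeights.
Variables (R : realType) (V : choiceType).
Implicit Types (F G P Q : (V -> R) -> R) (L B K : R) (theta c : V -> R) (s : seq V).
Implicit Types (e : {fset V}).

Lemma cos_lip : lip 1 (@cos R).
Proof.
move=> a b; rewrite mul1r.
wlog ab : a b / a < b.
  move=> H; case: (ltgtP a b) => [/H//|/H|->]; last by rewrite !subrr.
  by rewrite distrC (distrC a).
have [z _ e] := MVT ab (fun z _ => is_derive_cos z)
  (continuous_subspaceT (@continuous_cos R)).
by rewrite distrC e normrM normrN (distrC a) ler_piMl// sin_max.
Qed.

Definition config_bounded B F : Prop := forall c, `|F c| <= B.

Lemma config_lipM F G B B' L L' : 0 <= B -> 0 <= B' ->
  config_bounded B F -> config_bounded B' G -> config_lip L F -> config_lip L' G ->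
  config_lip (B * L' + B' * L) (fun c => F c * G c).
Proof.
move=> B0 B'0 bF bG lF lG theta x t u.
set f := F _; set g := G _; set f' := F _; set g' := G _.
rewrite (_ : _ - _ = f * (g - g') + g' * (f - f')); last by ring.
rewrite (le_trans (ler_normD _ _))// !normrM mulrDl lerD//.
- by rewrite -mulrA ler_pM// ?bF ?lG.
- by rewrite -mulrA ler_pM// ?bG ?lF.
Qed.

Lemma config_boundedM F G B B' :
  config_bounded B F -> config_bounded B' G ->
  config_bounded (B * B') (fun c => F c * G c).
Proof. by move=> bF bG c; rewrite normrM ler_pM. Qed.

Lemma config_bound_ge0 B F : config_bounded B F -> 0 <= B.
Proof. by move=> /(_ (fun=> 0)); exact: le_trans. Qed.

Lemma edge_diff_lip theta x t u e :
  `|edge_diff (upd theta x t) e - edge_diff (upd theta x u) e| <= 2 * `|t - u|.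
Proof.
have h v : `|upd theta x t v - upd theta x u v| <= `|t - u|.
  by rewrite !updE; case: ifP => // _; rewrite subrr normr0.
rewrite /edge_diff; case: (enum_fset e) => [|v [|w [|z l]]];
  rewrite ?subrr ?normr0 ?mulr_ge0//.
rewrite (_ : _ - _ = (upd theta x t v - upd theta x u v) -
   (upd theta x t w - upd theta x u w)); last by ring.
by rewrite (le_trans (ler_normB _ _))// mulr_natl mulr2n lerD.
Qed.

Lemma config_lip_edge (f : R -> R) L e : 0 <= L -> lip L f ->
  config_lip (L * 2) (fun c => f (edge_diff c e)).
Proof.
move=> L0 Lf theta x t u; apply: le_trans (Lf _ _) _.
by rewrite -mulrA ler_wpM2l// edge_diff_lip.
Qed.

Definition bounded_lip F : Prop :=
  (exists B, config_bounded B F) /\ (exists2 L, 0 <= L & config_lip L F).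

Lemma bounded_lipM F G : bounded_lip F -> bounded_lip G ->
  bounded_lip (fun c => F c * G c).
Proof.
move=> [[B bF] [L L0 lF]] [[B' bG] [L' L'0 lG]].
have B0 := config_bound_ge0 bF; have B'0 := config_bound_ge0 bG.
split; first by exists (B * B'); exact: config_boundedM.
by exists (B * L' + B' * L); [rewrite addr_ge0// mulr_ge0|exact: config_lipM].
Qed.

Lemma bounded_lip1 : bounded_lip (fun=> 1).
Proof.
split; first by exists 1 => c; rewrite normr1.
by exists 0 => // theta x t u; rewrite subrr normr0 mul0r.
Qed.

Lemma bounded_lip_villain K e : 0 < K ->
  bounded_lip (fun c => villain_weight K (edge_diff c e)).
Proof.
move=> K0; split.
  by exists (villain_bound K) => c; rewrite ger0_norm ?villain_weight_ge0 ?villain_weight_le.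
have [L L0 Lv] := @villain_weight_lipschitz R K K0.
by exists (L * 2); [rewrite mulr_ge0|exact: config_lip_edge].
Qed.

(** The class is stable under products. Regularity serves the passage to the limit, periodicity and
    splitting serve the rotation, and the lower bound makes the denominators positive. *)
Definition ginibre_weight P : Prop := [/\ bounded_lip P, config_periodic P, splits P &
  exists2 m, 0 < m & forall c, m <= P c].

Lemma ginibre_weight1 : ginibre_weight (fun=> 1).
Proof.
split; [exact: bounded_lip1| |exact: splits1|by exists 1].
by move=> theta x t k.
Qed.

Lemma ginibre_weightM P Q : ginibre_weight P -> ginibre_weight Q ->
  ginibre_weight (fun c => P c * Q c).
Proof.
move=> [rP pP sP [m m0 mP]] [rQ pQ sQ [m' m'0 mQ]]; split.
- exact: bounded_lipM.
- exact: config_periodicM.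
- exact: splitsM.
- exists (m * m'); rewrite ?mulr_gt0// => c.
  by rewrite ler_pM// ltW.
Qed.

Lemma ginibre_weight_villain K e : 0 < K ->
  ginibre_weight (fun c => villain_weight K (edge_diff c e)).
Proof.
move=> K0; split; [exact: bounded_lip_villain| |exact: splits_villain|].
- by apply: edge_diff_periodic => phi k; rewrite villain_weight_periodic.
- exists (expR (- (K / 2) * pi ^+ 2)); first exact: expR_gt0.
  by move=> c; exact: villain_weight_lb.
Qed.

Lemma ginibre_weight_prod (K : {fset V} -> R) (es : seq {fset V}) :
  (forall e, e \in es -> 0 < K e) ->
  ginibre_weight (fun c => \prod_(e <- es) villain_weight (K e) (edge_diff c e)).
Proof.
elim: es => [|e es IH] K0.
  rewrite (_ : (fun c => _) = fun=> 1); first exact: ginibre_weight1.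
  by apply/funext => c; rewrite big_nil.
rewrite (_ : (fun c => _) = fun c => villain_weight (K e) (edge_diff c e) *
   \prod_(e <- es) villain_weight (K e) (edge_diff c e)); last first.
  by apply/funext => c; rewrite big_cons.
apply: ginibre_weightM; first by apply: ginibre_weight_villain; rewrite K0 ?mem_head.
by apply: IH => e' he'; rewrite K0// inE he' orbT.
Qed.

End NiceWeights.

(** * Correlations on the torus as limits of grid correlations *)

Section Correlation.
Variables (R : realType) (V : choiceType).
Implicit Types (F P W : (V -> R) -> R) (K : R) (c : V -> R) (s : seq V).
Implicit Types (e : {fset V}) (x y : V).

Definition torus_integral s F : R := angle_integral s F (fun=> 0).

Definition correlation s x y W : R :=
  torus_integral s (fun c => cos (c x - c y) * W c) / torus_integral s W.

Lemma bounded_lip_cos x y : @bounded_lip R V (fun c => cos (c x - c y)).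
Proof.
split; first by exists 1 => c; exact: cos_max.
exists 2 => // theta z t u; rewrite -[2]mul1r -mulrA.
apply: (le_trans (cos_lip _ _)); rewrite ler_wpM2l//.
have h v : `|upd theta z t v - upd theta z u v| <= `|t - u|.
  by rewrite !updE; case: ifP => // _; rewrite subrr normr0.
rewrite (_ : _ - _ - _ = (upd theta z t x - upd theta z u x) -
   (upd theta z t y - upd theta z u y)); last by ring.
by rewrite (le_trans (ler_normB _ _))// mulr_natl mulr2n lerD.
Qed.

Lemma torus_integral_cvg s F : bounded_lip F ->
  mesh R n ^+ size s * \sum_(c <- configs n s (fun=> 0)) F c @[n --> \oo] -->
  torus_integral s F.
Proof. by move=> [_ [L L0 LF]]; exact: cvg_riemann LF. Qed.

Lemma le_torus_integral s F G : bounded_lip F -> bounded_lip G -> (forall c, F c <= G c) ->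
  torus_integral s F <= torus_integral s G.
Proof.
move=> rF rG FG; apply: (ler_cvg_to (@torus_integral_cvg s _ rF) (@torus_integral_cvg s _ rG)).
apply: nearW => n; rewrite ler_wpM2l ?exprn_ge0 ?divr_ge0 ?mulr_ge0 ?pi_ge0//.
by apply: ler_sum.
Qed.

Lemma torus_integral_gt0 s P : ginibre_weight P -> 0 < torus_integral s P.
Proof.
move=> [rP _ _ [m m0 mP]].
apply: (@lt_le_trans _ _ ((2 * pi) ^+ size s * m)).
  by rewrite mulr_gt0// exprn_gt0// mulr_gt0// pi_gt0.
apply: (ler_cvg_to (cvg_cst _) (@torus_integral_cvg s _ rP)).
apply: nearW => n.
(* The constant [m] is summed over [n.*2.+1] to the power [size s] configurations, so its Riemann
   sum is exact. *)
have -> : (2 * pi) ^+ size s * m =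
    mesh R n ^+ size s * \sum_(c <- configs n s (fun=> 0 : R)) m.
  rewrite -(mesh_period R n) exprMn -mulrA; congr (_ * _).
  elim: s (fun=> 0) => [|z s IH] theta; first by rewrite big_configs_nil mul1r.
  rewrite big_configs_cons; under eq_bigr do rewrite -IH.
  by rewrite sumr_const card_ord -[RHS]mulr_natl exprS mulrA.
rewrite ler_wpM2l ?exprn_ge0 ?divr_ge0 ?mulr_ge0 ?pi_ge0//.
by apply: ler_sum.
Qed.

Lemma correlation_le1 s x y W : ginibre_weight W -> correlation s x y W <= 1.
Proof.
move=> nW; have [rW _ _ [m m0 mW]] := nW.
rewrite ler_pdivrMr ?torus_integral_gt0// mul1r; apply: le_torus_integral => //.
  by apply: bounded_lipM => //; exact: bounded_lip_cos.
by move=> c; rewrite ler_piMl ?cos_le1// (le_trans (ltW m0)).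
Qed.

(** Once the positive denominators are cleared, this is the limit of [ginibre_grid], both sides
    carrying the same power of the mesh. *)
Lemma ginibre_torus K (w : R -> R) P e s x y : 0 < K ->
  (forall n, grid_average n (villain_weight K) w) ->
  ginibre_weight P -> ginibre_weight (fun c => w (edge_diff c e)) ->
  correlation s x y (fun c => P c * w (edge_diff c e)) <=
  correlation s x y (fun c => P c * villain_weight K (edge_diff c e)).
Proof.
move=> K0 avg nP nw.
have nPw := ginibre_weightM nP nw.
have nPv := ginibre_weightM nP (ginibre_weight_villain e K0).
have [rP pP sP _] := nP; have [rw _ _ _] := nw.
have rv := @bounded_lip_villain R V K e K0.
rewrite ler_pdivrMr ?torus_integral_gt0// mulrAC ler_pdivlMr ?torus_integral_gt0//.
have reg Q : bounded_lip Q -> bounded_lip (fun c => cos (c x - c y) * (P c * Q c)).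
  by move=> rQ; apply: bounded_lipM; [exact: bounded_lip_cos|exact: bounded_lipM].
have c1 := @torus_integral_cvg s _ (bounded_lipM rP rv).
have c2 := @torus_integral_cvg s _ (reg _ rw).
have c3 := @torus_integral_cvg s _ (reg _ rv).
have c4 := @torus_integral_cvg s _ (bounded_lipM rP rw).
rewrite mulrC; apply: (ler_cvg_to (cvgM c1 c2) (cvgM c3 c4)).
apply: nearW => n /=; rewrite [leLHS]mulrACA [leRHS]mulrACA ler_wpM2l//.
  by rewrite mulr_ge0// exprn_ge0// divr_ge0 ?mulr_ge0 ?pi_ge0.
under [X in _ * X <= _]eq_bigr do rewrite mulrA.
under [X in _ <= X * _]eq_bigr do rewrite mulrA.
exact: ginibre_grid.
Qed.

Lemma correlation_villain_mono K K' P e s x y : 0 < K -> K <= K' -> ginibre_weight P ->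
  correlation s x y (fun c => P c * villain_weight K (edge_diff c e)) <=
  correlation s x y (fun c => P c * villain_weight K' (edge_diff c e)).
Proof.
move=> K0; rewrite le_eqVlt => /predU1P[-> //|KK'] nP.
apply: ginibre_torus => //; first exact: lt_trans KK'.
- by move=> n; exact: grid_average_villain.
- exact: ginibre_weight_villain.
Qed.

(** An absent edge has the constant weight 1, an average of grid translates of the Villain
    weight. *)
Lemma correlation_add_edge K P e s x y : 0 < K -> ginibre_weight P ->
  correlation s x y P <=
  correlation s x y (fun c => P c * villain_weight K (edge_diff c e)).
Proof.
move=> K0 nP.
have := @ginibre_torus K (fun=> 1) P e s x y K0 (fun n => @grid_average_cst R n K K0) nP
  (ginibre_weight1 _ _).
by rewrite (_ : (fun c => P c * 1) = P)//; apply/funext => c; rewrite mulr1.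
Qed.

Definition edge_weight (K : {fset V} -> R) (es : seq {fset V}) c : R :=
  \prod_(e <- es) villain_weight (K e) (edge_diff c e).

Lemma correlation_add_edges (K : {fset V} -> R) es es' s x y :
  (forall e, e \in es ++ es' -> 0 < K e) ->
  correlation s x y (edge_weight K es') <=
  correlation s x y (edge_weight K (es ++ es')).
Proof.
elim: es => [//|e es IH] K0.
have K0' e' : e' \in es ++ es' -> 0 < K e'.
  by move=> h; rewrite K0// inE h orbT.
apply: (le_trans (IH K0')).
rewrite (_ : edge_weight K ((e :: es) ++ es') = fun c =>
   edge_weight K (es ++ es') c * villain_weight (K e) (edge_diff c e)).
  apply: correlation_add_edge; first by rewrite K0 ?mem_head.
  exact: ginibre_weight_prod.
by apply/funext => c; rewrite /edge_weight big_cons mulrC.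
Qed.

(** Each ignored angle gives a factor [n.*2.+1] on the grid, which its mesh factor turns into
    exactly [2 * pi] before the limit is taken. *)
Lemma torus_integral_subset s s' F : uniq s -> uniq s' -> {subset s' <= s} ->
  bounded_lip F ->
  (forall theta x t, x \in s -> x \notin s' -> F (upd theta x t) = F theta) ->
  torus_integral s F = (2 * pi) ^+ (size s - size s') * torus_integral s' F.
Proof.
move=> us us' sub rF indep.
have h : (2 * pi) ^+ (size s - size s') *
    (mesh R n ^+ size s' * \sum_(c <- configs n s' (fun=> 0)) F c) @[n --> \oo] -->
    (2 * pi) ^+ (size s - size s') * torus_integral s' F.
  by apply: cvgMr => //; exact: torus_integral_cvg.
apply: cvg_unique (@torus_integral_cvg s _ rF) _ => //.
apply: cvg_trans h; apply: near_eq_cvg; apply: nearW => n.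
rewrite (sum_configs_subset _ _ us us' sub indep) mulrA.
have e : size s = (size s - size s' + size s')%N by rewrite subnK// uniq_leq_size.
rewrite -(mesh_period R n) exprMn {3}e exprD; ring.
Qed.

(** The powers of [2 * pi] from the extra angles cancel between numerator and denominator. *)
Lemma correlation_subset s s' x y W : uniq s -> uniq s' -> {subset s' <= s} ->
  x \in s' -> y \in s' -> ginibre_weight W ->
  (forall theta z t, z \notin s' -> W (upd theta z t) = W theta) ->
  correlation s x y W = correlation s' x y W.
Proof.
move=> us us' sub xs ys [rW _ _ _] indep.
rewrite /correlation (@torus_integral_subset s s' W)//; last first.
  by move=> theta z t _; exact: indep.
rewrite (@torus_integral_subset s s')//; first last.
- move=> theta z t _ zs; rewrite indep// !updE.
  rewrite (negPf (_ : x != z)); last by apply: contraNneq zs => <-.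
  by rewrite (negPf (_ : y != z)) //; apply: contraNneq zs => <-.
- by apply: bounded_lipM => //; exact: bounded_lip_cos.
have p0 : (2 * pi) ^+ (size s - size s') != 0 :> R.
  by rewrite gt_eqF// exprn_gt0// mulr_gt0// pi_gt0.
by rewrite invfM mulrACA mulfV// mul1r.
Qed.

End Correlation.

(** * Two-point functions: edges, volume and infinite-volume limit *)

Section TwoPoint.
Variables (R : realType) (V : choiceType).
Implicit Types (beta : R) (J : {fset V} -> R) (G H : finite_graph V) (x y : V).

Lemma two_pointE beta J G x y : two_point beta J G x y =
  correlation (verts G) x y (edge_weight (fun e => beta * J e) (edges G)).
Proof. by []. Qed.

Lemma eq_edge_weight (K K' : {fset V} -> R) (es : seq {fset V}) :
  {in es, K =1 K'} -> edge_weight K es = edge_weight K' es.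
Proof.
by move=> KK'; apply/funext => c; apply: eq_big_seq => e /KK' ->.
Qed.

Lemma edge_weight_rem (K : {fset V} -> R) (es : seq {fset V}) e0 : e0 \in es ->
  edge_weight K es = fun c =>
    edge_weight K (rem e0 es) c * villain_weight (K e0) (edge_diff c e0).
Proof.
by move=> he; apply/funext => c; rewrite /edge_weight (big_rem e0)//= mulrC.
Qed.

Lemma edge_diff_upd (c : V -> R) x t (e : {fset V}) : x \notin e ->
  edge_diff (upd c x t) e = edge_diff c e.
Proof.
rewrite /edge_diff -[x \notin e]/(x \notin enum_fset e).
case: (enum_fset e) => [|u [|v [|w l]]]//=.
by rewrite !inE negb_or !updE ![_ == x]eq_sym => /andP[/negPf-> /negPf->].
Qed.

Lemma two_point_edge_mono beta J J' G e0 x y : 0 < beta ->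
  (forall e, e \in edges G -> 0 < J e) -> e0 \in edges G -> J e0 <= J' e0 ->
  (forall e, e \in edges G -> e != e0 -> J e = J' e) ->
  two_point beta J G x y <= two_point beta J' G x y.
Proof.
move=> b0 J0 he0 JJ' eJ; rewrite !two_pointE !(edge_weight_rem _ he0).
have -> : edge_weight (fun e => beta * J' e) (rem e0 (edges G)) =
    edge_weight (fun e => beta * J e) (rem e0 (edges G)).
  apply: eq_edge_weight => e; rewrite mem_rem_uniq ?fset_uniq// inE => /andP[ne he].
  by rewrite eJ.
apply: correlation_villain_mono; rewrite ?ler_pM2l ?mulr_gt0 ?J0//.
by apply: ginibre_weight_prod => e /mem_rem he; rewrite mulr_gt0 ?J0.
Qed.

(** The new vertices are added first, as isolated ones, which leaves the correlation unchanged; then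
    the missing edges are added one by one, each raising it. *)
Lemma two_point_volume_mono beta J J' G H x y : 0 < beta -> subgraph G H ->
  (forall e, e \in edges H -> 0 < J' e) ->
  (forall e, e \in edges G -> J e = J' e) ->
  x \in verts G -> y \in verts G ->
  two_point beta J G x y <= two_point beta J' H x y.
Proof.
move=> b0 [/fsubsetP vGH /fsubsetP eGH] J'0 eJ xG yG; rewrite !two_pointE.
have K0 e : e \in edges H -> 0 < beta * J' e by move=> he; rewrite mulr_gt0 ?J'0.
have -> : edge_weight (fun e => beta * J e) (edges G) =
    edge_weight (fun e => beta * J' e) (edges G).
  by apply: eq_edge_weight => e /eJ ->.
have nG : ginibre_weight (edge_weight (fun e => beta * J' e) (edges G)).
  by apply: ginibre_weight_prod => e /eGH /K0.
rewrite -(@correlation_subset _ _ (verts H))//; last first.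
  move=> theta z t zG; apply: eq_big_seq => e eG.
  rewrite edge_diff_upd//; apply: contraNN zG.
  exact: (fsubsetP (edges_verts eG)).
pose es := [seq e <- edges H | e \notin edges G].
have -> : edge_weight (fun e => beta * J' e) (edges H) =
    edge_weight (fun e => beta * J' e) (es ++ edges G).
  apply/funext => c; apply: perm_big; apply: uniq_perm; rewrite ?fset_uniq//.
    rewrite cat_uniq filter_uniq ?fset_uniq//= andbT; apply/hasPn => e eG.
    by rewrite mem_filter eG.
  move=> e; rewrite mem_cat mem_filter.
  by case: (boolP (e \in edges G)) => [/eGH ->|]; rewrite ?orbT ?orbF.
apply: correlation_add_edges => e; rewrite mem_cat mem_filter.
by move=> /orP[/andP[_]|/eGH]; exact: K0.
Qed.

Lemma subgraph_le (G : nat -> finite_graph V) m n :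
  (forall k, subgraph (G k) (G k.+1)) -> (m <= n)%N -> subgraph (G m) (G n).
Proof.
move=> GS; elim: n => [|n IH]; first by rewrite leqn0 => /eqP ->; split.
rewrite leq_eqVlt ltnS => /predU1P[->|/IH [v1 e1]]; first by split.
by have [v2 e2] := GS n; split; [exact: fsubset_trans v2|exact: fsubset_trans e2].
Qed.

Lemma eventually_subset (T : choiceType) (D : nat -> {fset T}) (l : seq T) :
  (forall m n, (m <= n)%N -> D m `<=` D n)%fset ->
  (forall v, v \in l -> exists n, v \in D n) ->
  exists n, {subset l <= D n}.
Proof.
move=> DS; elim: l => [|v l IH] hl; first by exists 0%N.
have [n hn] := IH (fun w wl => hl w (@mem_behead _ (v :: l) w wl)).
have [m hm] := hl v (mem_head _ _).
exists (maxn m n) => w; rewrite inE => /predU1P[->|/hn].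
  by apply: (fsubsetP (DS _ _ (leq_maxl m n))).
by apply: (fsubsetP (DS _ _ (leq_maxr m n))).
Qed.

Lemma exhaustion_subgraph (g : graph V) (G : nat -> finite_graph V) H :
  exhaustion g G -> (forall e, e \in edges H -> gedges g e) ->
  exists n, subgraph H (G n).
Proof.
move=> [_ GS Gv Ge] Hg.
have [n1 h1] : exists n, {subset verts H <= verts (G n)}.
  apply: eventually_subset => [m n mn|v _]; last exact: Gv.
  by have [] := subgraph_le GS mn.
have [n2 h2] : exists n, {subset edges H <= edges (G n)}.
  apply: eventually_subset => [m n mn|e /Hg]; last exact: Ge.
  by have [] := subgraph_le GS mn.
exists (maxn n1 n2); split; apply/fsubsetP.
- by move=> v /h1; apply/fsubsetP; have [] := subgraph_le GS (leq_maxl n1 n2).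
- by move=> e /h2; apply/fsubsetP; have [] := subgraph_le GS (leq_maxr n1 n2).
Qed.

Definition edgeless (S : {fset V}) : finite_graph V.
Proof. by exists S fset0 => e; rewrite inE. Defined.

(** The limit is the supremum over all finite subgraphs containing [x] and [y], hence the same for
    every exhaustion. A nearly optimal subgraph is eventually contained in [G n], and volume
    monotonicity squeezes the values. *)
Lemma two_point_cvg beta (g : graph V) J x y : 0 < beta ->
  (forall e, gedges g e -> 0 < J e) ->
  exists l : R, forall G : nat -> finite_graph V, exhaustion g G ->
    two_point beta J (G n) x y @[n --> \oo] --> l.
Proof.
move=> b0 J0.
pose A := [set r | exists H, [/\ forall e, e \in edges H -> gedges g e,
  x \in verts H, y \in verts H & r = two_point beta J H x y]].
have supA : has_sup A.
  split.
    (* Nonemptiness only requires some finite subgraph containing both vertices; the one without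
       edges always qualifies. *)
    exists (two_point beta J (edgeless [fset x; y]%fset) x y).
    by exists (edgeless [fset x; y]%fset); split => //=; rewrite ?inE ?eqxx ?orbT.
  exists 1 => _ [H [Hg xH yH ->]]; rewrite two_pointE; apply: correlation_le1.
  by apply: ginibre_weight_prod => e /Hg eg; rewrite mulr_gt0 ?J0.
exists (sup A) => G exG; have [Gg GS _ _] := exG.
apply/cvgrPdist_le => eps eps0.
have [_ [H [Hg xH yH ->]] hH] := sup_adherent eps0 supA.
have [N [vN eN]] := exhaustion_subgraph exG Hg.
near=> n.
have [vNn eNn] : subgraph (G N) (G n)
  by apply: subgraph_le => //; near: n; exact: nbhs_infty_ge.
have subn : subgraph H (G n).
  by split; [exact: fsubset_trans vNn|exact: fsubset_trans eNn].
have le1 : two_point beta J H x y <= two_point beta J (G n) x y.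
  by apply: two_point_volume_mono => // e /Gg /J0.
have le2 : two_point beta J (G n) x y <= sup A.
  apply: sup_upper_bound => //; exists (G n); split => //; first exact: Gg.
  - by apply: (fsubsetP subn.1).
  - by apply: (fsubsetP subn.1).
by rewrite ger0_norm ?subr_ge0// lerBlDr -lerBlDl (le_trans _ le1)// ltW.
Unshelve. all: by end_near. Qed.

End TwoPoint.

Theorem corollaryA4 (R : realType) (beta : R) (beta_gt0 : 0 < beta)
    (V : choiceType) :
  [/\ (* monotonicity in the coupling constant of each edge *)
      forall (G : finite_graph V) (J J' : {fset V} -> R) (e0 : {fset V}) (x y : V),
        (forall e, e \in edges G -> 0 < J e) ->
        (forall e, e \in edges G -> 0 < J' e) ->
        e0 \in edges G ->
        J e0 <= J' e0 ->
        (forall e, e \in edges G -> e != e0 -> J e = J' e) ->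
        x \in verts G -> y \in verts G ->
        two_point beta J G x y <= two_point beta J' G x y,
      (* monotonicity in the volume *)
      forall (G H : finite_graph V) (J J' : {fset V} -> R) (x y : V),
        subgraph G H ->
        (forall e, e \in edges G -> 0 < J e) ->
        (forall e, e \in edges H -> 0 < J' e) ->
        (forall e, e \in edges G -> J e = J' e) ->
        x \in verts G -> y \in verts G ->
        two_point beta J G x y <= two_point beta J' H x y
    & (* existence of the infinite-volume limit *)
      forall (g : graph V) (J : {fset V} -> R) (x y : V),
        infinite_set [set: V] ->
        locally_finite g ->
        (forall e, gedges g e -> 0 < J e) ->
        exists l : R, forall G : nat -> finite_graph V,
          exhaustion g G ->
          two_point beta J (G n) x y @[n --> \oo] --> l].
Proof.
split.
- move=> G J J' e0 x y J0 _ he0 JJ' eJ _ _.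
  exact: (two_point_edge_mono _ _ beta_gt0 J0 he0 JJ' eJ).
- move=> G H J J' x y GH _ J'0 eJ xG yG.
  exact: two_point_volume_mono.
- move=> g J x y _ _ J0.
  exact: two_point_cvg.
Qed.
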